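(* Let $f(\cdot;0,1)$ be a probability density on $\mathbb{R}$ satisfying Conditions C1–C4 (stated in the context), let $\Psi_0\in\boldsymbol{\Psi}_m$ and $\sigma_0>0$, and let $X_1,X_2,\ldots$ be i.i.d. with density $g(x;\Psi_0,\sigma_0)$. Suppose that for each $n$, $(\bar\Psi,\bar\sigma)=(\bar\Psi_n,\bar\sigma_n)\in\boldsymbol{\Psi}_m\times(0,\infty)$ is an estimator (a function of $X_1,\ldots,X_n$) such that, for some constant $c>-\infty$ not depending on $n$, $$\ell_n(\bar\Psi,\bar\sigma)-\ell_n(\Psi_0,\sigma_0)\geq c \quad\text{for all } n.$$ Then, almost surely, $D(\bar\Psi_n,\Psi_0)\to 0$ and $\bar\sigma_n\to\sigma_0$ as $n\to\infty$.
   Context: Fix a positive integer $m$. Let $f(x;0,1)$ be a probability density on $\mathbb{R}$ and, for $\mu\in\mathbb{R}$, $\sigma>0$, set $f(x;\mu,\sigma)=\sigma^{-1}f((x-\mu)/\sigma;0,1)$. Let $$\boldsymbol{\Psi}_m=\Big\{\Psi(\mu)=\textstyle\sum_{j=1}^m\alpha_j I(\mu_j\le\mu):\ \alpha_j\ge0,\ \sum_{j=1}^m\alpha_j=1,\ \mu_j\in\mathbb{R}\Big\}$$ (cumulative distribution functions of mixing distributions with at most $m$ support points). For $\Psi\in\boldsymbol{\Psi}_m$ and $\sigma>0$ define the mixture density $g(x;\Psi,\sigma)=\int_{\mathbb{R}} f(x;\mu,\sigma)\,d\Psi(\mu)=\sum_{j=1}^m\alpha_j f(x;\mu_j,\sigma)$,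 and the log-likelihood $\ell_n(\Psi,\sigma)=\sum_{i=1}^n\log g(X_i;\Psi,\sigma)$. For $\Psi_1,\Psi_2\in\boldsymbol{\Psi}_m$ define $D(\Psi_1,\Psi_2)=\int_{\mathbb{R}}|\Psi_1(\mu)-\Psi_2(\mu)|e^{-|\mu|}\,d\mu$. Conditions: (C1) identifiability: if $\Psi_1,\Psi_2\in\boldsymbol{\Psi}_m$, $\sigma_1,\sigma_2>0$ and $g(x;\Psi_1,\sigma_1)=g(x;\Psi_2,\sigma_2)$ for all $x$, then $\Psi_1=\Psi_2$ and $\sigma_1=\sigma_2$. (C2) $\int_{\mathbb{R}}|\log g(x;\Psi_0,\sigma_0)|\,g(x;\Psi_0,\sigma_0)\,dx<\infty$, where $(\Psi_0,\sigma_0)$ is the true parameter. (C3) There exist constants $v_0>0$, $v_1>0$, $\beta>1$ such that $f(x;0,1)\le\min\{v_0,\ v_1|x|^{-\beta}\}$ for all $x\in\mathbb{R}$. (C4) $x\mapsto f(x;0,1)$ is continuous. *)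

(* Defs.v *)
From HB Require Import structures.
From mathcomp Require Import all_boot all_order all_algebra.
From mathcomp Require Import all_classical all_reals all_analysis.
Set Implicit Arguments. Unset Strict Implicit. Unset Printing Implicit Defensive.
Import Order.TTheory GRing.Theory Num.Theory.
Import numFieldNormedType.Exports.
Local Open Scope classical_set_scope.
Local Open Scope ring_scope.

Section Defs.
Variable R : realType.

(* A point of Psi_m is represented by weights alpha and support points mu. *)
Definition valid_mix (m : nat) (alpha mu : 'I_m -> R) : Prop :=
  (forall j, 0 <= alpha j) /\ \sum_(j < m) alpha j = 1.

Definition mixCDF (m : nat) (alpha mu : 'I_m -> R) (t : R) : R :=
  \sum_(j < m) alpha j * (if mu j <= t then 1 else 0).

Definition locscale (f : R -> R) (mu sigma x : R) : R :=
  sigma^-1 * f ((x - mu) / sigma).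

Definition mixdens (f : R -> R) (m : nat) (alpha mu : 'I_m -> R) (sigma x : R) : R :=
  \sum_(j < m) alpha j * locscale f (mu j) sigma x.

Definition elog (x : R) : \bar R := if 0 < x then (ln x)%:E else -oo%E.

Definition loglik (f : R -> R) (m : nat) (alpha mu : 'I_m -> R) (sigma : R)
  (n : nat) (xs : nat -> R) : \bar R :=
  (\sum_(i < n) elog (mixdens f alpha mu sigma (xs i)))%E.

Definition Dist (m : nat) (a1 m1 a2 m2 : 'I_m -> R) : \bar R :=
  (\int[@lebesgue_measure R]_(t in [set: R])
     (`|mixCDF a1 m1 t - mixCDF a2 m2 t| * expR (- `|t|))%:E)%E.

Definition mutually_independent d (T : measurableType d) (P : probability T R)
  (X : nat -> T -> R) : Prop :=
  forall (s : seq nat) (A : nat -> set R), uniq s ->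
    (forall i, measurable (A i)) ->
    P (\bigcap_(i in [set` s]) (X i @^-1` A i)) =
    (\big[*%E/1%E]_(i <- s) P (X i @^-1` A i))%E.

End Defs.

(* Main.v *)
Require Import Defs.
From HB Require Import structures.
From mathcomp Require Import all_boot all_order all_algebra.
From mathcomp Require Import all_classical all_reals all_analysis.
From mathcomp Require Import measurable_realfun ring lra.
Set Implicit Arguments. Unset Strict Implicit. Unset Printing Implicit Defensive.
Import Order.TTheory GRing.Theory Num.Theory.
Import numFieldNormedType.Exports.
Local Open Scope classical_set_scope.
Local Open Scope ring_scope.

(** The strong law of large numbers is replaced by Chernoff bounds. If [Z >= 0]
    and [E Z(X) < 1], then [E prod_(i < n) Z(X_i)] decays geometrically, so by
    Markov and Borel-Cantelli [prod_(i < n) Z(X_i)] is almost surely eventually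
    below any positive constant. Fix [s] in ]0, 1[ with [(1 - s) beta > 1]; by (C3)
    the function [g0^(1-s)] is integrable, [g0] being the true density. Taking
    [Z = (G / g0)^s] shows that a set of parameters whose densities are all bounded
    by an envelope [G] with [int G^s g0^(1-s) < 1] is eventually left for ever by
    the estimator. The location parameters are compactified to [-oo, +oo]. At a
    limit parameter with positive scale and limit density [g' <> g0], AM-GM gives
    [int g'^s g0^(1-s) < 1], and [g' + e + M 1_{|x| > B}] is an envelope near it; if
    [g' = g0] then (C1) applies. Large scales are excluded by a constant envelope.
    For scales tending to [0] the density is at most [C / sigma] on a set of small
    mass around the limit locations and at most [C sigma^(beta-1)] elsewhere; a
    Chernoff bound on the number of observations in this set shows that the
    likelihood is eventually too small. A finite cover concludes. *)

(** * Change of variables in weighted integrals *)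

Section weighted_integral.
Context d d' (T : measurableType d) (T' : measurableType d') (R : realType).
Variables (mu : {measure set T -> \bar R}) (W : T -> R) (X : T -> T').
Hypothesis W0 : forall x, 0 <= W x.
Hypothesis mW : measurable_fun [set: T] W.
Hypothesis mX : measurable_fun [set: T] X.
Import HBNNSimple.
Local Open Scope ereal_scope.

Lemma weighted_integral_nnsfun (h : {nnsfun T' >-> R}) :
  \int[mu]_x (W x * h (X x))%:E =
  \sum_(y \in range h) y%:E * \int[mu]_x (W x * \1_(h @^-1` [set y]) (X x))%:E.
Proof.
under eq_integral do rewrite (fimfunE h) mulr_fsumr//.
under eq_integral do rewrite -fsumEFin//.
rewrite ge0_integral_fsum//.
- apply: eq_fsbigr => y; rewrite inE => -[z _ hy].
  rewrite -ge0_integralZl//.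
  + by apply: eq_integral => x _; rewrite -EFinM mulrCA.
  + apply/measurable_EFinP/measurable_funM => //.
    exact: measurableT_comp.
  + by move=> x _; rewrite lee_fin mulr_ge0.
  + by rewrite lee_fin -hy.
- move=> y; apply/measurable_EFinP/measurable_funM => //.
  apply: measurable_funM => //; exact: measurableT_comp.
- move=> y x _; rewrite lee_fin mulr_ge0//.
  by have := nnfun_muleindic_ge0 h y (X x); rewrite -EFinM lee_fin.
Qed.

Lemma weighted_integral_approx (Z : T' -> R) (mZ : measurable_fun [set: T'] (EFin \o Z)) :
  (forall x, (0 <= Z x)%R) ->
  \int[mu]_x (W x * Z (X x))%:E =
  limn (fun n => \int[mu]_x (W x * nnsfun_approx measurableT mZ n (X x))%:E).
Proof.
move=> Z0.
rewrite -monotone_convergence//.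
- apply: eq_integral => x _; apply/esym/cvg_lim => //.
  under eq_fun do rewrite EFinM.
  rewrite EFinM; apply: cvgeZl => //.
  by apply: (cvg_nnsfun_approx measurableT mZ) => // y _; rewrite lee_fin.
- move=> n; apply/measurable_EFinP/measurable_funM => //.
  exact: measurableT_comp.
- by move=> n x _; rewrite lee_fin mulr_ge0.
- move=> x _ m n mn; rewrite lee_fin ler_wpM2l//; exact/lefP/nd_nnsfun_approx.
Qed.

End weighted_integral.

Import HBNNSimple.

(** Agreement on indicators passes to simple functions by linearity and to [Z] by monotone
    convergence. The weights make it possible to integrate out one observation while the other
    factors of a product are carried along. *)
Lemma weighted_integral_transfer d1 d2 d' (T1 : measurableType d1)
    (T2 : measurableType d2) (T' : measurableType d') (R : realType)
    (mu1 : {measure set T1 -> \bar R}) (mu2 : {measure set T2 -> \bar R})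
    (W1 : T1 -> R) (W2 : T2 -> R) (X1 : T1 -> T') (X2 : T2 -> T') (Z : T' -> R) :
  (forall x, 0 <= W1 x) -> measurable_fun [set: T1] W1 -> measurable_fun [set: T1] X1 ->
  (forall x, 0 <= W2 x) -> measurable_fun [set: T2] W2 -> measurable_fun [set: T2] X2 ->
  (forall A, measurable A -> \int[mu1]_x (W1 x * \1_A (X1 x))%:E =
                             \int[mu2]_x (W2 x * \1_A (X2 x))%:E)%E ->
  (forall y, 0 <= Z y) -> measurable_fun [set: T'] Z ->
  (\int[mu1]_x (W1 x * Z (X1 x))%:E = \int[mu2]_x (W2 x * Z (X2 x))%:E)%E.
Proof.
move=> W10 mW1 mX1 W20 mW2 mX2 eqA Z0 /measurable_EFinP mZ.
rewrite !(weighted_integral_approx _ _ _ _ mZ)//.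
congr (limn _); apply/funext => n.
rewrite !weighted_integral_nnsfun//; apply: eq_fsbigr => y _.
by congr (_ * _)%E; exact: eqA.
Qed.

(** * Products of independent variables and Chernoff bounds *)

Section iid_product.
Context d (T : measurableType d) (R : realType) (P : probability T R).
Variables (X : nat -> T -> R) (g : R -> R).
Hypothesis mX : forall i, measurable_fun [set: T] (X i).
Hypothesis g0 : forall x, 0 <= g x.
Hypothesis mg : measurable_fun [set: R] g.
Hypothesis lawX : forall i (A : set R), measurable A ->
  P (X i @^-1` A) = (\int[@lebesgue_measure R]_(x in A) (g x)%:E)%E.
Hypothesis indX : mutually_independent P X.
Variable Z : R -> R.
Hypothesis Z0 : forall x, 0 <= Z x.
Hypothesis mZ : measurable_fun [set: R] Z.
Variable rho : R.
Hypothesis rhoE : (\int[@lebesgue_measure R]_x (Z x * g x)%:E = rho%:E)%E.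

Let rho_ge0 : 0 <= rho.
Proof.
by rewrite -lee_fin -rhoE; apply: integral_ge0 => x _; rewrite lee_fin mulr_ge0.
Qed.

Let mZX n : measurable_fun [set: T] (fun w => \prod_(i < n) Z (X i w)).
Proof. by apply: measurable_prod => i _; exact: measurableT_comp. Qed.

Let prZ0 n w : 0 <= \prod_(i < n) Z (X i w).
Proof. by apply: prodr_ge0. Qed.

Let tl n k (A : nat -> set R) : set T := \bigcap_(i in [set` iota n k]) (X i @^-1` A i).

Let mtl n k A : (forall i, measurable (A i)) -> measurable (tl n k A).
Proof.
move=> mA; apply: bigcap_measurableType => i _.
rewrite -[_ @^-1` _]setTI; exact: mX.
Qed.

(** Independence is given for events only, so the induction on [n] carries the indicator of an event
    on the next [k] observations. To integrate out [Z (X n)] it suffices to treat an indicator of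
    [X n], and this is absorbed into the tail event, now of length [k.+1]. *)
Lemma integral_prod_tail n k (A : nat -> set R) : (forall i, measurable (A i)) ->
  (\int[P]_w (\prod_(i < n) Z (X i w) * \1_(tl n k A) w)%:E =
   (rho ^+ n)%:E * \big[*%E/1%E]_(i <- iota n k) P (X i @^-1` A i))%E.
Proof.
elim: n k A => [|n IHn] k A mA.
  under eq_integral do rewrite big_ord0 mul1r.
  rewrite integral_indic// ?setIT; last exact: mtl.
  rewrite expr0 mul1e; exact: (indX (iota_uniq 0 k) mA).
pose W w := \prod_(i < n) Z (X i w) * \1_(tl n.+1 k A) w.
pose q := (\big[*%E/1%E]_(i <- iota n.+1 k) P (X i @^-1` A i))%E.
have qf : q \is a fin_num.
  rewrite /q; apply: (big_ind (fun x => x \is a fin_num)) => //.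
    by move=> x y; exact: fin_numM.
  move=> i _; apply: fin_num_measure; rewrite -[_ @^-1` _]setTI; exact: mX.
have q0 : 0 <= fine q.
  by apply: fine_ge0; rewrite /q; apply: (big_ind (fun x => 0 <= x)%E) => //; exact: mule_ge0.
have -> : (\int[P]_w (\prod_(i < n.+1) Z (X i w) * \1_(tl n.+1 k A) w)%:E =
  \int[P]_w (W w * Z (X n w))%:E)%E.
  by apply: eq_integral => w _; rewrite big_ord_recr/= /W mulrAC.
(* Under the weight [W], the variable [X n] has density [g] up to the factor [rho ^+ n * fine q],
   the total mass of [W]. *)
rewrite (@weighted_integral_transfer _ _ _ _ _ _ _ P (@lebesgue_measure R)
   W (fun x => rho ^+ n * fine q * g x) (X n) id)//.
- under eq_integral do rewrite -mulrA (mulrC (g _)) EFinM.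
  rewrite ge0_integralZl//; first last.
  + by rewrite lee_fin mulr_ge0// exprn_ge0.
  + by move=> x _; rewrite lee_fin mulr_ge0.
  + by apply/measurable_EFinP/measurable_funM.
  by rewrite rhoE -EFinM mulrAC -exprSr EFinM fineK.
- by move=> w; rewrite mulr_ge0.
- apply: measurable_funM => //; apply: measurable_indic; exact: mtl.
- by move=> w; rewrite !mulr_ge0// exprn_ge0.
- exact: measurable_funM.
move=> B mB.
pose A' i := if i == n then B else A i.
have mA' i : measurable (A' i) by rewrite /A'; case: ifP.
transitivity (\int[P]_w (\prod_(i < n) Z (X i w) * \1_(tl n k.+1 A') w)%:E)%E.
  apply: eq_integral => w _; rewrite /W -mulrA; congr (_ * _)%:E.
  rewrite !indicE -natrM mulnb; congr (nat_of_bool _)%:R.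
  apply/idP/idP.
    move=> /andP[]; rewrite !inE => h hB i /=; rewrite inE => /predU1P[->|hi].
      by rewrite /A' eqxx.
    rewrite /A'; case: eqP => [-> //|_]; exact: h.
  rewrite !inE => h; apply/andP; split; rewrite inE.
    move=> i /= hi; have := h i; rewrite /A' /= inE hi orbT => /(_ isT).
    case: eqP => // ein; move: hi; rewrite ein mem_iota ltnn//.
  by have := h n; rewrite /A' /= inE eqxx => /(_ isT).
rewrite IHn//= big_cons; under [RHS]eq_integral do rewrite -mulrA EFinM.
rewrite ge0_integralZl//; first last.
+ by rewrite lee_fin mulr_ge0// exprn_ge0.
+ by move=> x _; rewrite lee_fin mulr_ge0.
+ by apply/measurable_EFinP/measurable_funM => //; exact: measurable_indic.
rewrite EFinM fineK// -muleA; congr (_ * _)%E; rewrite muleC; congr (_ * _)%E.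
  rewrite /q big_seq [RHS]big_seq; apply: eq_bigr => i.
  by rewrite mem_iota /A' => /andP[ni _]; rewrite gtn_eqF.
rewrite /A' eqxx lawX// [LHS]integral_mkcond epatch_indic.
by apply: eq_integral => x _; rewrite EFinM.
Qed.

Lemma integral_prod_iid n :
  (\int[P]_w (\prod_(i < n) Z (X i w))%:E = (rho ^+ n)%:E)%E.
Proof.
have := @integral_prod_tail n 0 (fun=> setT) (fun=> measurableT).
rewrite /= big_nil mule1 => <-; apply: eq_integral => w _.
rewrite indicE mem_set ?mulr1// => i //=.
Qed.

Lemma prod_iid_eventually_lt (C : R) : 0 < C -> rho < 1 ->
  {ae P, forall w, \forall n \near \oo, \prod_(i < n) Z (X i w) < C}.
Proof.
move=> C0 rho1.
pose F n := [set w | C <= \prod_(i < n) Z (X i w)].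
have mF n : measurable (F n).
  rewrite /F -[X in measurable X]setTI.
  rewrite (_ : [set w | _] = (fun w => \prod_(i < n) Z (X i w)) @^-1` `[C, +oo[%classic).
    exact: mZX.
  by apply/seteqP; split=> w /=; rewrite in_itv/= andbT.
(* Markov's inequality; the bounds form a summable geometric series, so Borel-Cantelli applies to
   [F]. *)
have PF n : (P (F n) <= (C^-1 * rho ^+ n)%:E)%E.
  rewrite EFinM -integral_prod_iid -[P (F n)]mul1e.
  have -> : 1%E = (C^-1 * C)%:E by rewrite mulVf// gt_eqF.
  rewrite EFinM -muleA lee_pmul2l ?lte_fin ?invr_gt0//.
  have mE : measurable_fun setT (fun w => (\prod_(i < n) Z (X i w))%:E).
    exact/measurable_EFinP.
  rewrite -integral_cst//.
  apply: (@le_trans _ _ (\int[P]_(w in F n) (\prod_(i < n) Z (X i w))%:E)%E).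
    apply: ge0_le_integral => //.
    - by move=> w _; rewrite lee_fin ltW.
    - exact: measurable_funTS.
  by apply: ge0_subset_integral => // w _; rewrite lee_fin.
have : P (lim_sup_set F) = 0%E.
  apply: lim_sup_set_cvg0 => //.
  apply: (@le_lt_trans _ _ (\sum_(n <oo) (C^-1 * rho ^+ n)%:E)%E).
    by apply: lee_nneseries => [n _ _|n _]; [exact: measure_ge0|exact: PF].
  have cv : series (geometric C^-1 rho) n @[n --> \oo] --> C^-1 * (1 - rho)^-1.
    by apply: cvg_geometric_series; rewrite ger0_norm.
  rewrite (_ : (fun n => _) = EFin \o series (geometric C^-1 rho)); last first.
    by apply/funext => n /=; rewrite /series/= sumEFin.
  by rewrite EFin_lim ?ltry//; apply/cvg_ex; eexists; exact: cv.
move=> h; exists (lim_sup_set F); split => //.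
  apply: bigcap_measurable => // k _; exact: bigcup_measurable.
move=> w /= hw n _; apply: contrapT => hn; apply: hw.
exists n => // k /= nk; rewrite ltNge; apply/negP => Ck; apply: hn; exists k => //.
Qed.

End iid_product.

(** * Powers, integrals on the line and elementary inequalities *)

Section real_analysis.
Context {R : realType}.
Local Notation mu := (@lebesgue_measure R).
Implicit Types (a b s x : R).

Lemma powR_cvgy0 (p : R) : 0 < p -> (1 + x) `^ (- p) @[x --> +oo] --> (0 : R).
Proof.
move=> p0; apply/cvgrPdist_lt => e e0; near=> x.
have x0 : 0 < 1 + x by rewrite addr_gt0//; near: x; exact: nbhs_pinfty_gt.
rewrite sub0r normrN ger0_norm ?powR_ge0// powRN invf_plt ?posrE ?powR_gt0//.
have -> : e^-1 = (e^-1 `^ p^-1) `^ p.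
  by rewrite -powRrM mulVf ?gt_eqF// powRr1// invr_ge0 ltW.
apply: gt0_ltr_powR => //; rewrite ?nnegrE ?powR_ge0 ?(ltW x0)//.
rewrite -ltrBlDl; near: x; exact: nbhs_pinfty_gt.
Unshelve. all: by end_near. Qed.

Lemma continuous_powR_gt0 (p : R) x : 0 < x -> {for x, continuous (@powR R ^~ p)}.
Proof.
move=> x0; apply: differentiable_continuous; apply/derivable1_diffP.
by apply: derivable_powR; rewrite in_itv/= andbT.
Qed.

Lemma integral_powR_tail_lty (p : R) : 1 < p ->
  (\int[mu]_x ((1 + `|x|) `^ (- p))%:E < +oo)%E.
Proof.
move=> p1.
have norm1 x : 0 < 1 + `|x| by rewrite ltr_wpDr.
rewrite (@ge0_symfun_integralT _ (fun x => (1 + `|x|) `^ (- p)))//; first last.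
- by move=> x /=; rewrite normrN.
- move=> x; apply: (@continuous_comp _ _ _ (fun x : R => 1 + `|x|) (@powR R ^~ (- p))).
    by apply: cvgD; [exact: cvg_cst|exact: norm_continuous].
  exact: continuous_powR_gt0.
rewrite -set_itvcy.
have -> : (\int[mu]_(x in `[0%R, +oo[) ((1 + `|x|) `^ (- p))%:E =
           \int[mu]_(x in `[0%R, +oo[) ((1 + x) `^ (- p))%:E)%E.
  by apply: eq_integral => x; rewrite inE/= in_itv/= andbT => x0; rewrite ger0_norm.
(* Antiderivative of the integrand on the half-line to which evenness has reduced the integral. *)
pose F x := (1 - p)^-1 * (1 + x) `^ (- (p - 1)).
have dF x : 0 <= x -> is_derive x 1 F ((1 + x) `^ (- p)).
  move=> x0.
  have x1 : 0 < 1 + x by rewrite ltr_pwDl.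
  have dG : is_derive x 1 (fun x => (1 + x) `^ (- (p - 1)))
      ((- (p - 1)) * (1 + x) `^ (- p)).
    have d1 : is_derive x 1 (fun x => 1 + x) (1 : R).
      rewrite (_ : (fun x => 1 + x) = shift 1); first exact: is_derive_shift.
      by apply/funext => y; rewrite /shift addrC.
    have := @is_derive1_comp _ (@powR R ^~ (- (p - 1))) (fun x : R => 1 + x) x _ _
      (@is_derive1_powR _ (- (p - 1)) _ x1) d1.
    by rewrite mulr1 (_ : - (p - 1) - 1 = - p)//; lra.
  have := @is_deriveZ _ _ _ _ (1 - p)^-1 _ _ _ dG.
  rewrite /= scalerA (_ : (1 - p)^-1 * - (p - 1) = 1) ?scale1r//.
  by rewrite opprB mulVf//; apply/eqP; lra.
rewrite (@ge0_continuous_FTC2y _ _ F _ 0).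
- by rewrite -EFinB -EFinM ltry.
- by move=> x _; exact: powR_ge0.
- apply: continuous_in_subspaceT => x; rewrite inE/= in_itv/= andbT => x0.
  apply: (@continuous_comp _ _ _ (fun x : R => 1 + x) (@powR R ^~ (- p))).
    by apply: cvgD; [exact: cvg_cst|exact: cvg_id].
  by apply: continuous_powR_gt0; rewrite ltr_pwDl.
- rewrite -(mulr0 (1 - p)^-1); apply: cvgMr.
  by apply: powR_cvgy0; lra.
- by move=> x /ltW /dF [].
- apply: cvg_at_right_filter; apply: differentiable_continuous.
  by apply/derivable1_diffP; case: (dF 0 (lexx _)).
- by move=> x; rewrite in_itv/= andbT => /ltW/dF [_ <-]; rewrite derive1E.
Qed.

(** With [A] the weighted mean, apply [1 + u <= expR u] to the logarithms of [a / A] and [b / A] and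
    average: the right-hand sides average to 1. The first inequality is strict, since [a = A] would
    force [a = b]. *)
Lemma powR_weighted_AMGM_lt a b s : 0 < s < 1 -> 0 <= a -> 0 <= b -> a != b ->
  a `^ s * b `^ (1 - s) < s * a + (1 - s) * b.
Proof.
move=> /andP[s0 s1]; rewrite le0r => /predU1P[->|a0].
  move=> b0 b1; rewrite powR0 ?gt_eqF// mul0r mulr0 add0r mulr_gt0 ?subr_gt0//.
  by rewrite lt_def b0 eq_sym b1.
rewrite le0r => /predU1P[->|b0] ab.
  by rewrite powR0 ?mulr0 ?addr0 ?mulr_gt0// subr_eq0 gt_eqF.
set A := s * a + (1 - s) * b.
have A0 : 0 < A by rewrite addr_gt0// mulr_gt0// subr_gt0.
rewrite /powR !gt_eqF// -expRD -[ltRHS]lnK ?posrE// ltr_expR.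
have h1 : 1 + (ln a - ln A) < a / A.
  rewrite -[a in ltRHS]lnK ?posrE// -[A in ltRHS]lnK ?posrE// -expRN -expRD.
  apply: expR_gt1Dx; rewrite subr_eq0; apply: contra ab => /eqP /ln_inj.
  rewrite !posrE => /(_ a0 A0) aA; rewrite -subr_eq0.
  have : (1 - s) * (a - b) = 0 by move: aA; rewrite /A; lra.
  by move=> /eqP; rewrite mulf_eq0 => /orP[|//]; rewrite subr_eq0 => /eqP; lra.
have h2 : 1 + (ln b - ln A) <= b / A.
  rewrite -[b in leRHS]lnK ?posrE// -[A in leRHS]lnK ?posrE// -expRN -expRD.
  exact: expR_ge1Dx.
have h3 : s * (a / A) + (1 - s) * (b / A) = 1.
  by rewrite !mulrA -mulrDl divff// gt_eqF.
have h4 : s * (1 + (ln a - ln A)) < s * (a / A) by rewrite ltr_pM2l.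
have h5 : (1 - s) * (1 + (ln b - ln A)) <= (1 - s) * (b / A).
  by rewrite ler_pM2l// subr_gt0.
lra.
Qed.

Lemma powR_weighted_AMGM a b s : 0 < s < 1 -> 0 <= a -> 0 <= b ->
  a `^ s * b `^ (1 - s) <= s * a + (1 - s) * b.
Proof.
move=> s01 a0 b0; have [<-|ab] := eqVneq a b; last exact/ltW/powR_weighted_AMGM_lt.
rewrite -powRD; last by rewrite addrC subrK oner_eq0.
by rewrite addrC subrK powRr1// -mulrDl addrC subrK mul1r.
Qed.

(** The ratios [a / (a + b)] and [b / (a + b)] add up to 1, and each, being at most 1, is at most
    its own power of exponent [s]. *)
Lemma powR_subadditive a b s : 0 < s <= 1 -> 0 <= a -> 0 <= b ->
  (a + b) `^ s <= a `^ s + b `^ s.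
Proof.
move=> /andP[s0 s1]; rewrite le0r => /predU1P[->|a0].
  by rewrite add0r lerDr powR_ge0.
rewrite le0r => /predU1P[->|b0].
  by rewrite addr0 lerDl powR_ge0.
have ab : 0 < a + b by rewrite addr_gt0.
have h c : 0 < c -> c <= a + b -> c / (a + b) <= c `^ s / (a + b) `^ s.
  move=> c0 cab.
  have -> : c `^ s / (a + b) `^ s = (c / (a + b)) `^ s.
    rewrite powRM ?invr_ge0 ?ltW//; congr (_ * _).
    by rewrite -[(a + b)^-1]powR_inv1 ?ltW// -powRrM mulN1r powRN.
  apply: ger1_powR => //; rewrite divr_gt0//=.
  by rewrite ler_pdivrMr// mul1r.
have h1 := h a a0; have h2 := h b b0.
have : 1 <= (a `^ s + b `^ s) / (a + b) `^ s.
  rewrite -(divff (lt0r_neq0 ab)) !mulrDl lerD ?h1 ?h2//; lra.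
by rewrite ler_pdivlMr ?powR_gt0// mul1r.
Qed.

Lemma integral_locscale (f : R -> R) (m s : R) : 0 < s ->
  (forall x, 0 <= f x) -> continuous f ->
  (\int[mu]_x (locscale f m s x)%:E = \int[mu]_x (f x)%:E)%E.
Proof.
move=> s0 f0 cf; pose F x := (x - m) / s.
have dF x : is_derive x 1 F s^-1.
  have dG : is_derive x 1 (fun x => x - m) (1 : R).
    by apply: is_derive_eq; rewrite subr0.
  have := @is_deriveZ _ _ _ _ s^-1 _ _ _ dG.
  rewrite (_ : s^-1 *: 1 = s^-1) ?[LHS]mulr1// (_ : s^-1 \*: (fun x => x - m) = F)//.
  by apply/funext => y; rewrite /F mulrC.
have dE : F^`()%classic = cst s^-1 by apply/funext => x; rewrite derive1E; case: (dF x).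
rewrite (@increasing_ge0_integration_by_substitutionT _ F f)//.
- by apply: eq_integral => x _; rewrite dE /locscale mulrC.
- by move=> x y xy; rewrite /F ltr_pM2r ?invr_gt0// ltrD2r.
- by rewrite dE; exact: cst_continuous.
- by rewrite dE; exact: is_cvg_cst.
- by rewrite dE; exact: is_cvg_cst.
- apply/cvgrNyPlt => A; near=> x; rewrite /F ltr_pdivrMr// ltrBlDr.
  by near: x; apply: nbhs_ninfty_lt; rewrite num_real.
- apply/cvgryPgt => A; near=> x; rewrite /F ltr_pdivlMr// ltrBrDr.
  by near: x; apply: nbhs_pinfty_gt; rewrite num_real.
Unshelve. all: by end_near. Qed.

Lemma measurable_norm_gt (B : R) : measurable [set y : R | B < `|y|].
Proof.
rewrite (_ : [set _ | _] = (fun y => `|y|) @^-1` `]B, +oo[%classic).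
  rewrite -[X in measurable X]setTI; exact: normr_measurable.
by apply/seteqP; split=> y /=; rewrite in_itv/= andbT.
Qed.

(** Dominated convergence: at a fixed [x] the tail indicators with radius [n.+1] eventually
    vanish. *)
Lemma integral_tail_lt (h : R -> R) (e : R) : (forall x, 0 <= h x) ->
  measurable_fun [set: R] h -> (\int[mu]_x (h x)%:E < +oo)%E -> 0 < e ->
  exists2 B : R, 0 < B & (\int[mu]_x (h x * \1_[set y : R | B < `|y|] x)%:E < e%:E)%E.
Proof.
move=> h0 mh hoo e0.
pose f_ n x := (h x * \1_[set y : R | n.+1%:R < `|y|] x)%:E.
have mA n := measurable_norm_gt (n.+1%:R).
have mf n : measurable_fun setT (f_ n).
  by apply/measurable_EFinP/measurable_funM => //; exact: measurable_indic.
have f0 n x : (0 <= f_ n x)%E by rewrite lee_fin mulr_ge0.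
have [] := @dominated_convergence _ _ _ mu setT measurableT f_ (cst 0%E)
  (EFin \o h) mf.
- exact: measurable_cst.
- apply: aeW => x _; apply: cvg_near_cst; near=> n.
  rewrite /f_ indicE memNset ?mulr0//= => /ltW; apply/negP; rewrite -ltNge.
  rewrite -natr1 ltr_wpDr//; near: n; exact: nbhs_infty_gtr.
- apply/integrableP; split; first exact/measurable_EFinP.
  by under eq_integral do rewrite /= ger0_norm//.
- apply: aeW => x n _; rewrite gee0_abs// lee_fin ler_piMr//.
move=> _ _; rewrite integral0 => /fine_cvgP[fn] /cvgrPdist_lt/(_ _ e0) hn.
near \oo => n.
exists n.+1%:R => //.
rewrite -/(f_ n _) -[X in (X < _)%E]fineK ?lte_fin; last by near: n.
apply: le_lt_trans (ler_norm _) _; rewrite -normrN -[X in `|X|]sub0r.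
by near: n.
Unshelve. all: by end_near. Qed.

Lemma integral_expRN_norm_lty : (\int[mu]_x (expR (- `|x|))%:E < +oo)%E.
Proof.
have h := @integral_powR_tail_lty 2 (ltr1n _ 2).
have mw : measurable_fun setT (fun x : R => (1 + `|x|) `^ (- 2)).
  apply: (measurableT_comp (@measurable_powR R (- 2))).
  by apply: measurable_funD => //; exact: normr_measurable.
have me : measurable_fun setT (fun x : R => expR (- `|x|)).
  apply: measurableT_comp => //; apply: measurableT_comp => //.
(* The domination is the square of [(1 + |x|) / 2 <= expR (|x| / 2)]. *)
apply: (@le_lt_trans _ _ (\int[mu]_x (4%:E * ((1 + `|x|) `^ (- 2))%:E))%E).
  apply: ge0_le_integral => //.
  - exact/measurable_EFinP.
  - by apply/measurable_EFinP/measurable_funM.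
  - move=> x _; rewrite -EFinM lee_fin expRN powRN powR_mulrn ?addr_ge0//.
    rewrite -[4]invrK -invfM lef_pV2 ?posrE ?expR_gt0 ?mulr_gt0 ?exprn_gt0 ?ltr_wpDr//.
    have -> : expR `|x| = expR (`|x| / 2) ^+ 2 :> R.
      by rewrite -expRM_natr; congr expR; lra.
    have -> : 4^-1 * (1 + `|x|) ^+ 2 = ((1 + `|x|) / 2) ^+ 2 by lra.
    rewrite ler_sqr ?nnegrE ?expR_ge0 ?divr_ge0 ?addr_ge0//.
    have := expR_ge1Dx (`|x| / 2); have := normr_ge0 x; lra.
rewrite ge0_integralZl//; first by rewrite lte_mul_pinfty.
exact/measurable_EFinP.
Qed.

End real_analysis.

(** * A coordinatewise bound on the distance between mixing distributions *)

Section distance.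
Context {R : realType} (m : nat).
Local Notation mu := (@lebesgue_measure R).

Lemma norm_step_diff (p q t : R) :
  `|(if p <= t then 1 else 0) - (if q <= t then 1 else 0)| <=
  \1_(`[Num.min p q, Num.max p q] : set R) t :> R.
Proof.
rewrite indicE mem_setE/= in_itv/= ge_min le_max.
have [pt|tp] := leP p t; have [qt|tq] := leP q t => /=;
  rewrite ?subrr ?normr0 ?subr0 ?sub0r ?normrN ?normr1 ?ler0n//.
- by rewrite (ltW tq) orbT.
- by rewrite (ltW tp).
Qed.

(** Each component contributes a change of weight, integrated against the exponential, and a change
    of location, supported between the two jumps. The second term carries the weight [a2 j], so
    where [a2 j = 0] the locations may be arbitrarily far apart; this tolerates components that
    escape to infinity. *)
Lemma Dist_le (C : R) (a1 m1 a2 m2 : 'I_m -> R) :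
  (\int[mu]_x (expR (- `|x|))%:E <= C%:E)%E -> (forall j, 0 <= a2 j) ->
  (Dist a1 m1 a2 m2 <=
   (\sum_j (`|a1 j - a2 j| * C + a2 j * `|m1 j - m2 j|))%:E)%E.
Proof.
move=> eC a20.
have me : measurable_fun setT (fun x : R => expR (- `|x|)).
  by apply: measurableT_comp => //; apply: measurableT_comp.
have mI j : measurable (`[Num.min (m1 j) (m2 j), Num.max (m1 j) (m2 j)] : set R) by [].
have mstep (p : R) : measurable_fun setT (fun t : R => (if p <= t then 1 else 0) : R).
  rewrite (_ : (fun t => _) = \1_(`[p, +oo[ : set R)); first exact: measurable_indic.
  by apply/funext => t; rewrite indicE mem_setE/= in_itv/= andbT; case: (p <= t).
have mcdf (a p : 'I_m -> R) : measurable_fun setT (mixCDF a p).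
  by apply: measurable_sum => j; apply: measurable_funM.
pose b j t := (`|a1 j - a2 j| * expR (- `|t|) +
  a2 j * \1_(`[Num.min (m1 j) (m2 j), Num.max (m1 j) (m2 j)] : set R) t)%:E.
have mb j : measurable_fun setT (b j).
  by apply/measurable_EFinP/measurable_funD; apply: measurable_funM => //;
    exact: measurable_indic.
have b0 j t : (0 <= b j t)%E.
  by rewrite lee_fin addr_ge0// mulr_ge0// expR_ge0.
apply: (@le_trans _ _ (\int[mu]_t (\sum_(j <- enum 'I_m) b j t))%E).
  apply: ge0_le_integral => //.
  - apply/measurable_EFinP/measurable_funM => //; apply: measurableT_comp => //.
    by apply: measurable_funB; exact: mcdf.
  - by apply: emeasurable_sum.
  - move=> t _; rewrite sumEFin lee_fin /mixCDF -sumrB.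
    rewrite big_enum/=; apply: (le_trans (ler_wpM2r (expR_ge0 _) (ler_norm_sum _ _ _))).
    rewrite mulr_suml; apply: ler_sum => j _.
    set p1 := (if m1 j <= t then 1 else 0); set p2 := (if m2 j <= t then 1 else 0).
    have -> : a1 j * p1 - a2 j * p2 = (a1 j - a2 j) * p1 + a2 j * (p1 - p2) by ring.
    have p1le : `|p1| <= 1 by rewrite /p1; case: ifP; rewrite ?normr1 ?normr0.
    have e1 : expR (- `|t|) <= 1 by rewrite expR_le1 oppr_le0.
    apply: (le_trans (ler_wpM2r (expR_ge0 _) (ler_normD _ _))).
    rewrite mulrDl; apply: lerD.
      by rewrite ler_wpM2r ?expR_ge0// normrM ler_piMr.
    rewrite normrM (ger0_norm (a20 j)) -mulrA ler_wpM2l//.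
    apply: le_trans (norm_step_diff (m1 j) (m2 j) t).
    by rewrite ler_piMr.
rewrite ge0_integral_sum// big_enum/= -sumEFin; apply: lee_sum => j _.
rewrite /b; under eq_integral do rewrite EFinD.
rewrite ge0_integralD//; first last.
- by apply/measurable_EFinP/measurable_funM => //; exact: measurable_indic.
- by move=> t _; rewrite lee_fin mulr_ge0.
- by apply/measurable_EFinP/measurable_funM.
rewrite EFinD; apply: leeD.
  under eq_integral do rewrite EFinM.
  rewrite ge0_integralZl//; last exact/measurable_EFinP.
  by rewrite EFinM lee_wpmul2l.
under eq_integral do rewrite EFinM.
rewrite ge0_integralZl//; [|exact/measurable_EFinP/measurable_indic|by rewrite lee_fin].
rewrite integral_indic//= setIT.
rewrite (lebesgue_measure_itv `[Num.min (m1 j) (m2 j), Num.max (m1 j) (m2 j)])/=.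
rewrite EFinM lee_wpmul2l ?lee_fin//.
rewrite lte_fin; case: ifPn => _; last by rewrite lee_fin.
rewrite -EFinB lee_fin /Num.max /Num.min; case: ltP => h.
  by rewrite distrC ler_norm.
exact: ler_norm.
Qed.

End distance.

(** * Two-point compactification of the line *)

Section compactification.
Context {R : realType}.

(** A bijection of the line onto []-1, 1[]; the endpoints of [[-1, 1]] stand for the infinite
    locations. *)
Definition contractR (x : R) : R := x / (1 + `|x|).
(* At the points at infinity [`|t| = 1] this is [t / 0 = 0]. *)
Definition expandR (t : R) : R := t / (1 - `|t|).

Lemma contractR_norm_lt1 x : `|contractR x| < 1.
Proof.
have h : 0 < 1 + `|x| by rewrite ltr_wpDr.
by rewrite /contractR normrM normfV (gtr0_norm h) ltr_pdivrMr// mul1r ltrDr.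
Qed.

Lemma norm_contractR x : `|contractR x| = `|x| / (1 + `|x|).
Proof. by rewrite /contractR normrM normfV (@gtr0_norm _ (1 + _))// ltr_wpDr. Qed.

Lemma contractRK : cancel contractR expandR.
Proof.
move=> x; have h : 1 + `|x| != 0 by rewrite gt_eqF// ltr_wpDr.
rewrite /expandR norm_contractR /contractR.
have -> : 1 - `|x| / (1 + `|x|) = (1 + `|x|)^-1 by field.
by rewrite invrK mulfVK.
Qed.

Lemma continuous_expandR t : `|t| < 1 -> {for t, continuous expandR}.
Proof.
move=> t1; apply: cvgM; first exact: cvg_id.
apply: cvgV; first by rewrite subr_eq0 gt_eqF.
by apply: cvgB; [exact: cvg_cst|exact: norm_continuous].
Qed.

(** Only those [t'] that are images of finite locations are constrained, since an estimator yields
    no others. The later neighbourhood statements have the same form. *)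
Lemma near_contractR_expandR t (e : R) : `|t| < 1 -> 0 < e ->
  \forall t' \near t, forall x, t' = contractR x -> `|x - expandR t| < e.
Proof.
move=> t1 e0; have /cvgrPdist_lt/(_ _ e0) h := continuous_expandR t1.
by near=> t' => x tx; rewrite -[x]contractRK -tx distrC; near: t'.
Unshelve. all: by end_near. Qed.

(** [1 - |contractR x|] is the inverse of [1 + |x|], so closeness to an endpoint forces [|x|] to be
    large. *)
Lemma near_contractR_far t (A : R) : `|t| = 1 ->
  \forall t' \near t, forall x, t' = contractR x -> A < `|x|.
Proof.
move=> t1.
have e0 : 0 < (1 + `|A|)^-1 by rewrite invr_gt0 ltr_wpDr.
have /cvgrPdist_lt/(_ _ e0) h := @norm_continuous _ _ t.
near=> t' => x tx.
have : `| `|t| - `|t'| | < (1 + `|A|)^-1 by near: t'.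
rewrite t1 tx norm_contractR.
have x1 : 0 < 1 + `|x| by rewrite ltr_wpDr.
have -> : 1 - `|x| / (1 + `|x|) = (1 + `|x|)^-1 by field; rewrite gt_eqF.
have A1 : 0 < 1 + `|A| by rewrite ltr_wpDr.
rewrite ger0_norm ?invr_ge0 ?(ltW x1)// ltf_pV2 ?posrE// ltrD2l.
by apply: le_lt_trans; exact: ler_norm.
Unshelve. all: by end_near. Qed.

End compactification.

(** * Neighbourhoods in products *)

Section near_prod.
Context {T U : Type} (F : set_system T) (G : set_system U) {FF : Filter F} {FG : Filter G}.

Lemma near_prod_fst (P : T -> Prop) :
  (\forall x \near F, P x) -> \forall x \near F & y \near G, P x.
Proof. by move=> h; exists (P, setT) => //=; [split => //; exact: filterT|move=> [x y] []]. Qed.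

Lemma near_prod_snd (P : U -> Prop) :
  (\forall y \near G, P y) -> \forall x \near F & y \near G, P y.
Proof. by move=> h; exists (setT, P) => //=; [split => //; exact: filterT|move=> [x y] []]. Qed.

End near_prod.

Section near_projections.
Context {T U : topologicalType} (a : T) (b : U).

Lemma near_fst (P : T -> Prop) :
  (\forall x \near a, P x) -> \forall u \near (a, b), P u.1.
Proof. by move=> h; exact: near_prod_fst. Qed.

Lemma near_snd (P : U -> Prop) :
  (\forall x \near b, P x) -> \forall u \near (a, b), P u.2.
Proof. by move=> h; exact: near_prod_snd. Qed.

End near_projections.

(** * Bounds and limits of location-scale mixtures *)

Section mixture_density.
Context {R : realType} (m : nat) (f : R -> R) (v0 v1 beta : R).
Local Notation mu := (@lebesgue_measure R).
Hypothesis f_ge0 : forall x, 0 <= f x.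
Hypothesis f_cont : continuous f.
Hypothesis v0_gt0 : 0 < v0.
Hypothesis v1_gt0 : 0 < v1.
Hypothesis beta_gt1 : 1 < beta.
Hypothesis f_le_v0 : forall x, f x <= v0.
Hypothesis f_le_v1 : forall x, x != 0 -> f x <= v1 * `|x| `^ (- beta).

Let beta_gt0 : 0 < beta. Proof. exact: lt_trans beta_gt1. Qed.

Lemma le_powRN (x y p : R) : 0 <= p -> 0 < x -> x <= y -> y `^ (- p) <= x `^ (- p).
Proof.
move=> p0 x0 xy; have y0 := lt_le_trans x0 xy.
rewrite !powRN lef_pV2 ?posrE ?powR_gt0//.
by apply: ge0_ler_powR => //; rewrite nnegrE ltW.
Qed.

(** Merges the two bounds of (C3) into one that stays finite at the origin: [(1 + |y|) / 2] is at
    most 1 if [|y| <= 1] and at most [|y|] otherwise, whence the power of 2. *)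
Lemma density_le_decay y :
  f y <= (v0 + v1) * 2 `^ beta * (1 + `|y|) `^ (- beta).
Proof.
have y1 : 0 < 1 + `|y| by rewrite ltr_wpDr.
have E : 2 `^ beta * (1 + `|y|) `^ (- beta) = ((1 + `|y|) / 2) `^ (- beta).
  rewrite powRM ?invr_ge0 ?(ltW y1)// mulrC; congr (_ * _).
  by rewrite -[2^-1]powR_inv1// -powRrM mulrNN mul1r.
rewrite -mulrA E; have [yle|ylt] := leP `|y| 1.
  have h : 1 <= ((1 + `|y|) / 2) `^ (- beta).
    have h2 : (1 + `|y|) / 2 <= 1 by rewrite ler_pdivrMr// mul1r; lra.
    have := @le_powRN _ _ beta (ltW beta_gt0) (divr_gt0 y1 (ltr0n _ 2)) h2.
    by rewrite powR1.
  apply: (le_trans (f_le_v0 y)); apply: (@le_trans _ _ (v0 + v1)); first by rewrite lerDl ltW.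
  by rewrite ler_peMr// addr_ge0 ?ltW.
have yn0 : y != 0 by rewrite -normr_gt0 (lt_trans _ ylt).
apply: (le_trans (f_le_v1 yn0)); apply: ler_pM; rewrite ?powR_ge0 ?(ltW v1_gt0)//.
  by rewrite lerDr ltW.
apply: le_powRN; rewrite ?(ltW beta_gt0) ?divr_gt0// ler_pdivrMr//; lra.
Qed.

Lemma density_vanish (e : R) : 0 < e ->
  exists2 A : R, 0 < A & forall y, A < `|y| -> f y < e.
Proof.
move=> e0; pose A := (v1 / e) `^ beta^-1.
have A0 : 0 < A by rewrite powR_gt0// divr_gt0.
exists A => // y Ay; have y0 : 0 < `|y| by exact: lt_trans Ay.
rewrite normr_gt0 in y0; apply: (le_lt_trans (f_le_v1 y0)).
rewrite powRN ltr_pdivrMr ?powR_gt0 ?normr_gt0// mulrC -ltr_pdivrMr//.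
have -> : v1 / e = A `^ beta.
  by rewrite /A -powRrM mulVf ?gt_eqF// powRr1// ltW// divr_gt0.
by apply: gt0_ltr_powR; rewrite // nnegrE ltW.
Qed.

Lemma locscale_ge0 (a s x : R) : 0 < s -> 0 <= locscale f a s x.
Proof. by move=> s0; rewrite /locscale mulr_ge0// invr_ge0 ltW. Qed.

Lemma locscale_le (a s x : R) : 0 < s -> locscale f a s x <= v0 / s.
Proof. by move=> s0; rewrite /locscale mulrC ler_wpM2r// invr_ge0 ltW. Qed.

Lemma locscale_decay (a s : R) : 0 < s -> exists2 C : R, 0 < C &
  forall x, locscale f a s x <= C * (1 + `|x|) `^ (- beta).
Proof.
(* [K] is such that [1 + |x| <= K (1 + |y|)] whenever [x = a + s y]. *)
move=> s0; pose K := 1 + `|a| + s.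
have K0 : 0 < K by rewrite addr_gt0// ltr_pwDl.
exists (s^-1 * ((v0 + v1) * 2 `^ beta * K `^ beta)).
  by rewrite !mulr_gt0 ?invr_gt0 ?powR_gt0// addr_gt0.
move=> x; rewrite /locscale -[leRHS]mulrA ler_wpM2l ?invr_ge0 ?(ltW s0)//.
set y := (x - a) / s.
apply: (le_trans (density_le_decay y)); rewrite -[leRHS]mulrA ler_wpM2l//.
  by rewrite mulr_ge0 ?powR_ge0// addr_ge0 ?ltW.
have -> : K `^ beta * (1 + `|x|) `^ (- beta) = ((1 + `|x|) / K) `^ (- beta).
  have x1 : 0 <= 1 + `|x| by rewrite addr_ge0.
  rewrite mulrC powRM ?invr_ge0 ?(ltW K0)//; congr (_ * _).
  by rewrite -[K^-1]powR_inv1 ?(ltW K0)// -powRrM mulrNN mul1r.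
apply: le_powRN; rewrite ?(ltW beta_gt0)//.
  by rewrite divr_gt0// ltr_wpDr.
rewrite ler_pdivrMr//.
have xE : x = a + s * y by rewrite /y; field; rewrite gt_eqF.
have : `|x| <= `|a| + s * `|y|.
  by rewrite {1}xE (le_trans (ler_normD _ _))// normrM (gtr0_norm s0).
have h1 : 0 <= `|a| * `|y| by rewrite mulr_ge0.
have := normr_ge0 y; have := ltW s0.
by rewrite /K; lra.
Qed.

Lemma continuous_locscale (a s : R) : continuous (locscale f a s).
Proof.
move=> x; rewrite /locscale; apply: cvgM; first exact: cvg_cst.
apply: continuous_comp; last exact: f_cont.
by apply: cvgM; [apply: cvgB; [exact: cvg_id|exact: cvg_cst]|exact: cvg_cst].
Qed.

Lemma continuous_mixdens (a p : 'I_m -> R) s : continuous (mixdens f a p s).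
Proof.
move=> x; rewrite /mixdens; apply: cvg_big => [|j _]; first exact: add_continuous.
by apply: cvgM; [exact: cvg_cst|exact: continuous_locscale].
Qed.

Lemma measurable_mixdens (a p : 'I_m -> R) s : measurable_fun setT (mixdens f a p s).
Proof. by apply: continuous_measurable_fun; exact: continuous_mixdens. Qed.

Lemma mixdens_ge0 (a p : 'I_m -> R) s x : (forall j, 0 <= a j) -> 0 < s ->
  0 <= mixdens f a p s x.
Proof. by move=> a0 s0; apply: sumr_ge0 => j _; rewrite mulr_ge0// locscale_ge0. Qed.

Lemma mixdens_le (a p : 'I_m -> R) s x M : valid_mix a p ->
  (forall j, locscale f (p j) s x <= M) -> mixdens f a p s x <= M.
Proof.
move=> [a0 a1] h; rewrite -[leRHS]mul1r -a1 mulr_suml; apply: ler_sum => j _.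
by rewrite ler_wpM2l.
Qed.

Lemma mixdens_decay (a p : 'I_m -> R) s : valid_mix a p -> 0 < s ->
  exists2 C : R, 0 < C & forall x, mixdens f a p s x <= C * (1 + `|x|) `^ (- beta).
Proof.
move=> va s0.
have /choice[C hC] : forall j, exists C : R, 0 < C /\
    forall x, locscale f (p j) s x <= C * (1 + `|x|) `^ (- beta).
  by move=> j; have [C ? ?] := locscale_decay (p j) s0; exists C.
exists (1 + \sum_j C j).
  by rewrite ltr_pwDl// sumr_ge0// => j _; rewrite ltW//; case: (hC j).
move=> x; apply: mixdens_le => // j; have [C0 /(_ x) h] := hC j.
apply: (le_trans h); rewrite ler_wpM2r ?powR_ge0//.
rewrite (bigD1 j)//= addrCA lerDl addr_ge0// sumr_ge0// => i _.
by rewrite ltW//; case: (hC i).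
Qed.

(** Applied to the true density with [q = 1 - s], this is what makes constants and tails usable in
    an envelope. *)
Lemma integral_mixdens_powR_lty (a p : 'I_m -> R) s q : valid_mix a p -> 0 < s ->
  0 < q -> 1 < beta * q -> (\int[mu]_x (mixdens f a p s x `^ q)%:E < +oo)%E.
Proof.
move=> va s0 q0 bq; have [C C0 hC] := mixdens_decay va s0.
have h := integral_powR_tail_lty bq.
have mw : measurable_fun setT (fun x : R => (1 + `|x|) `^ (- (beta * q))).
  apply: (measurableT_comp (@measurable_powR R _)).
  by apply: measurable_funD => //; exact: normr_measurable.
apply: (@le_lt_trans _ _ (\int[mu]_x ((C `^ q)%:E * ((1 + `|x|) `^ (- (beta * q)))%:E))%E).
  apply: ge0_le_integral => //.
  - by move=> x _; rewrite lee_fin powR_ge0.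
  - apply/measurable_EFinP/(measurableT_comp (@measurable_powR R _)).
    exact: measurable_mixdens.
  - by apply/measurable_EFinP/measurable_funM.
  - move=> x _; rewrite -EFinM lee_fin -mulNr powRrM -powRM ?powR_ge0 ?(ltW C0)//.
    apply: ge0_ler_powR; rewrite ?nnegrE ?(ltW q0)//.
      by apply: mixdens_ge0 => //; case: va.
    by rewrite mulr_ge0 ?powR_ge0// ltW.
rewrite ge0_integralZl//; first by rewrite lte_mul_pinfty// lee_fin powR_ge0.
- exact/measurable_EFinP.
- by rewrite lee_fin powR_ge0.
Qed.

(* Limit of [locscale f p s x] as [contractR p] tends to [t]: a component whose
   location escapes to infinity disappears. *)
Definition climit (t s x : R) : R :=
  if `|t| < 1 then locscale f (expandR t) s x else 0.

(** If the location escapes, the standardised point is far out and [f] is small there, uniformly for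
    [|x| <= B]. Otherwise the kernel is jointly continuous in the point and the parameter, and
    compactness of [[-B, B]] gives the uniformity. *)
Lemma near_locscale_climit (t s B e : R) : `|t| <= 1 -> 0 < s -> 0 < e ->
  \forall u \near (t, s), forall p, u.1 = contractR p ->
    forall x, `|x| <= B -> `|locscale f p u.2 x - climit t s x| < e.
Proof.
move=> t1 s0 e0; rewrite /climit.
have s2 : s / 2 < s by rewrite ltr_pdivrMr// ltr_pMr// ltr1n.
have [tlt|tge] := ltP `|t| 1; last first.
  have tE : `|t| = 1 by apply/eqP; rewrite eq_le t1 tge.
  (* The kernel divides [f] by a scale that will exceed [s / 2], hence this threshold for [f]. *)
  have e1 : 0 < e * (s / 2) by rewrite mulr_gt0// divr_gt0.
  have [A A0 hA] := density_vanish e1.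
  (* For [|x| <= B] and a scale below [2 * s], this distance puts the standardised point beyond
     [A]. *)
  have h1 := near_contractR_far (`|B| + A * (2 * s)) tE.
  have h2 : \forall u \near (t, s), s / 2 < u.2 < 2 * s.
    apply: (@near_snd _ _ t s (fun s' => s / 2 < s' < 2 * s)).
    near=> s'; apply/andP; split; near: s'.
      exact: lt_nbhsr.
    by apply: lt_nbhsl; rewrite ltr_pMl// ltr1n.
  have h3 : \forall u \near (t, s), forall p, u.1 = contractR p ->
      `|B| + A * (2 * s) < `|p|.
    exact: near_fst h1.
  near=> u => p up x xB; rewrite subr0.
  have /andP[u1 u2] : s / 2 < u.2 < 2 * s by near: u.
  have u0 : 0 < u.2 by apply: lt_trans u1; rewrite divr_gt0.
  have pA : `|B| + A * (2 * s) < `|p| by move: p up; near: u.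
  rewrite ger0_norm ?locscale_ge0// /locscale mulrC ltr_pdivrMr//.
  apply: (@lt_trans _ _ (e * (s / 2))); last by rewrite ltr_pM2l.
  apply: hA; rewrite normrM normfV (gtr0_norm u0) ltr_pdivlMr//.
  apply: (@lt_le_trans _ _ (A * (2 * s))); first by rewrite ltr_pM2l.
  have := ler_norm B; have := lerB_dist p x; rewrite distrC; lra.
have := @segment_compact R (- B) B => /compact_near_coveringP.
pose H (x : R) (u : R * R) := locscale f (expandR u.1) u.2 x.
move=> /(_ (R * R)%type (nbhs (t, s)) (fun u x => `|H x u - H x (t, s)| < e) _).
have cH x : (fun z : R * (R * R) => H z.1 z.2) y @[y --> (x, (t, s))] --> H x (t, s).
  have c2 : z.2.2 @[z --> (x, (t, s))] --> s.
    by apply: (@cvg_comp _ _ _ snd snd); [exact: cvg_snd|exact: cvg_snd].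
  have c1 : z.2.1 @[z --> (x, (t, s))] --> t.
    by apply: (@cvg_comp _ _ _ snd fst); [exact: cvg_snd|exact: cvg_fst].
  rewrite /H /locscale; apply: cvgM; first by apply: cvgV => //; rewrite gt_eqF.
  apply: (@continuous_cvg _ _ _ _ _ _ f); first exact: f_cont.
  apply: cvgM; last by apply: cvgV => //; rewrite gt_eqF.
  apply: cvgB; first exact: cvg_fst.
  by apply: (@continuous_cvg _ _ _ _ _ _ expandR) => //; exact: continuous_expandR.
(* The comparison is with [H x' (t, s)] at the moving point [x'], so continuity enters twice:
   jointly, and in the point alone. *)
have key : forall x, `[- B, B]%classic x ->
    \forall x' \near x & u \near nbhs (t, s), `|H x' u - H x' (t, s)| < e.
  move=> x _; have e2 : 0 < e / 2 by rewrite divr_gt0.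
  have /cvgrPdist_lt/(_ _ e2) h := cH x.
  have h' : \forall x' \near x, `|H x (t, s) - H x' (t, s)| < e / 2.
    have := @continuous_locscale (expandR t) s x.
    by move=> /cvgrPdist_lt/(_ _ e2).
  have h'' : \forall z \near (x, (t, s)), `|H x (t, s) - H z.1 (t, s)| < e / 2.
    exact: near_fst h'.
  apply: filterS2 h h'' => -[x' u] /= h1 h2.
  have -> : H x' u - H x' (t, s) =
    (H x (t, s) - H x' (t, s)) - (H x (t, s) - H x' u) by ring.
  by apply: (le_lt_trans (ler_normB _ _)); lra.
move=> /(_ key) h; near=> u => p up x xB.
rewrite -[p]contractRK -up -/(H x u) -[X in _ - X]/(H x (t, s)).
have hu : `[- B, B]%classic `<=` (fun x => `|H x u - H x (t, s)| < e) by near: u.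
by apply: hu; rewrite /= in_itv/= -ler_norml.
Unshelve. all: by end_near. Qed.

End mixture_density.

(** * The strict inequality for Hellinger-type integrals *)

Section hellinger.
Context {R : realType} (s : R) (s01 : 0 < s < 1).
Local Notation mu := (@lebesgue_measure R).

Lemma measurable_powR_prod (g h : R -> R) (p q : R) :
  measurable_fun setT g -> measurable_fun setT h ->
  measurable_fun setT (fun x => g x `^ p * h x `^ q).
Proof.
by move=> mg mh; apply: measurable_funM;
  apply: (measurableT_comp (@measurable_powR R _)).
Qed.

(** Two continuous functions that differ at a point differ on a ball around it, which has positive
    measure. *)
Lemma ae_eq_continuous (g h : R -> R) : continuous g -> continuous h ->
  {ae mu, forall x, g x = h x} -> forall x, g x = h x.
Proof.
move=> cg ch [N [mN N0 sN]] x; apply: contrapT => gh.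
have : {for x, continuous (fun y => `|g y - h y|)}.
  by apply: continuous_comp; [apply: cvgB; [exact: cg|exact: ch]|exact: norm_continuous].
have p0 : 0 < `|g x - h x| by rewrite normr_gt0 subr_eq0; apply/eqP.
move=> /cvgrPdist_lt/(_ _ p0) /nbhs_ballP[e /= e0 he].
have muN : (mu (ball x e) <= mu N)%E.
  apply: le_measure; rewrite ?inE//; first exact: measurable_ball.
  move=> y /he /= hy; apply: sN => /= ghy; move: hy.
  by rewrite ghy subrr normr0 subr0 normr_id ltxx.
move: muN; rewrite N0 lebesgue_measure_ball ?(ltW e0)// => muN.
have : ((e *+ 2)%:E <= 0%:E)%E by exact: muN.
by rewrite lee_fin leNgt mulrn_wgt0.
Qed.

(* Equality in the weighted AM-GM inequality forces the two densities to agree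
   almost everywhere, hence everywhere. *)
Lemma hellinger_lt1 (g h : R -> R) :
  (forall x, 0 <= g x) -> (forall x, 0 <= h x) -> continuous g -> continuous h ->
  (\int[mu]_x (g x)%:E <= 1)%E -> (\int[mu]_x (h x)%:E <= 1)%E ->
  ~ (forall x, g x = h x) -> (\int[mu]_x (g x `^ s * h x `^ (1 - s))%:E < 1)%E.
Proof.
have /andP[s0 s1] := s01.
move=> g0 h0 cg ch ig ih neq; rewrite ltNge; apply/negP => J1; apply: neq.
have mg := continuous_measurable_fun cg; have mh := continuous_measurable_fun ch.
have mJ := measurable_powR_prod s (1 - s) mg mh.
(* The nonnegative defect in AM-GM. If the claim failed, its integral would be at most
   [1 - 1 = 0]. *)
pose k x := s * g x + (1 - s) * h x - g x `^ s * h x `^ (1 - s).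
have k0 x : 0 <= k x by rewrite subr_ge0 powR_weighted_AMGM.
have msgh : measurable_fun setT (fun x => s * g x + (1 - s) * h x).
  by apply: measurable_funD; apply: measurable_funM.
have mk : measurable_fun setT k by exact: measurable_funB.
have J0 x : 0 <= g x `^ s * h x `^ (1 - s) by rewrite mulr_ge0 ?powR_ge0.
have sum1 : (\int[mu]_x (s * g x + (1 - s) * h x)%:E <= 1)%E.
  under eq_integral do rewrite EFinD !EFinM.
  rewrite ge0_integralD//; first last.
  - by apply: emeasurable_funM => //; exact/measurable_EFinP.
  - by move=> x _; rewrite -EFinM lee_fin mulr_ge0// subr_ge0 ltW.
  - by apply: emeasurable_funM => //; exact/measurable_EFinP.
  - by move=> x _; rewrite -EFinM lee_fin mulr_ge0// ltW.
  rewrite !ge0_integralZl//; first last.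
  - by rewrite lee_fin ltW.
  - by move=> x _; rewrite lee_fin.
  - exact/measurable_EFinP.
  - by rewrite lee_fin subr_ge0 ltW.
  - by move=> x _; rewrite lee_fin.
  - exact/measurable_EFinP.
  have -> : (1 = s%:E * 1 + (1 - s)%:E * 1)%E by rewrite !mule1 -EFinD subrKC.
  by apply: leeD; apply: lee_wpmul2l; rewrite // lee_fin ?subr_ge0 ltW.
have splitk : (\int[mu]_x (s * g x + (1 - s) * h x)%:E =
   \int[mu]_x (k x)%:E + \int[mu]_x (g x `^ s * h x `^ (1 - s))%:E)%E.
  rewrite -ge0_integralD//.
  - by apply: eq_integral => x _; rewrite -EFinD /k subrK.
  - by move=> x _; rewrite lee_fin.
  - exact/measurable_EFinP.
  - by move=> x _; rewrite lee_fin.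
  - exact/measurable_EFinP.
have ik : (\int[mu]_x (k x)%:E = 0)%E.
  apply/eqP; rewrite eq_le integral_ge0 ?andbT; last by move=> x _; rewrite lee_fin.
  have : (\int[mu]_x (k x)%:E + 1 <= 0 + 1)%E.
    by rewrite add0e; apply: le_trans sum1; rewrite splitk leeD2l.
  by rewrite leeD2rE.
apply: ae_eq_continuous => //.
have /ae_eq_integral_abs : (\int[mu]_x `|(k x)%:E| = 0)%E.
  by rewrite -[RHS]ik; apply: eq_integral => x _; rewrite gee0_abs// lee_fin.
move=> /(_ measurableT); have mk' : measurable_fun setT (fun x => (k x)%:E).
  exact/measurable_EFinP.
move=> /(_ mk'); apply: filterS => x /(_ Logic.I) [] kx; apply/eqP.
apply: contraT => gh; have := powR_weighted_AMGM_lt s01 (g0 x) (h0 x) gh.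
by rewrite -subr_gt0 -/(k x) kx ltxx.
Qed.

End hellinger.

(** * Envelopes near a point of the compactified parameter space *)

Section envelope.
Context {R : realType} (m : nat) (f : R -> R) (v0 v1 beta : R).
Local Notation mu := (@lebesgue_measure R).
Hypothesis f_ge0 : forall x, 0 <= f x.
Hypothesis f_cont : continuous f.
Hypothesis v0_gt0 : 0 < v0.
Hypothesis v1_gt0 : 0 < v1.
Hypothesis beta_gt1 : 1 < beta.
Hypothesis f_le_v0 : forall x, f x <= v0.
Hypothesis f_le_v1 : forall x, x != 0 -> f x <= v1 * `|x| `^ (- beta).

(** Weights, contracted locations and scale. No constraint is built in, so limits with infinite
    locations or zero scale are points of the same space. *)
Definition param := ('rV[R]_m * 'rV[R]_m * R)%type.

Definition weight (th : param) (j : 'I_m) : R := th.1.1 ord0 j.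

Definition location (th : param) (j : 'I_m) : R := th.1.2 ord0 j.

Definition encode (a p : 'I_m -> R) (s : R) : param :=
  (\row_j a j, \row_j contractR (p j), s).

(** The density at a limit parameter. Components at infinity drop out, so its total mass may be
    smaller than the sum of the weights. *)
Definition mixlim (th : param) (x : R) : R :=
  \sum_j weight th j * climit f (location th j) th.2 x.

Lemma near_coord (v : 'rV[R]_m) j (P : R -> Prop) :
  (\forall x \near v ord0 j, P x) -> \forall u \near v, P ((u : 'rV[R]_m) ord0 j).
Proof. by move=> h; exact: (@coord_continuous R 1 m ord0 j v _ h). Qed.

Lemma near_weight (th : param) j (P : R -> Prop) :
  (\forall x \near weight th j, P x) -> \forall u \near th, P (weight u j).
Proof.
case: th => -[a t] s h.
apply: (@near_fst _ _ (a, t) s (fun u : 'rV[R]_m * 'rV[R]_m => P (u.1 ord0 j))).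
by apply: (@near_fst _ _ a t (fun u : 'rV[R]_m => P (u ord0 j))); exact: near_coord.
Qed.

Lemma near_location (th : param) j (P : R -> Prop) :
  (\forall x \near location th j, P x) -> \forall u \near th, P (location u j).
Proof.
case: th => -[a t] s h.
apply: (@near_fst _ _ (a, t) s (fun u : 'rV[R]_m * 'rV[R]_m => P (u.2 ord0 j))).
by apply: (@near_snd _ _ a t (fun u : 'rV[R]_m => P (u ord0 j))); exact: near_coord.
Qed.

Lemma near_scale (th : param) (P : R -> Prop) :
  (\forall x \near th.2, P x) -> \forall u \near th, P u.2.
Proof. by case: th => at_ s /= h; exact: (@near_snd _ _ at_ s P h). Qed.

Lemma near_location_scale (th : param) j (P : R * R -> Prop) :
  (\forall z \near (location th j, th.2), P z) ->
  \forall u \near th, P (location u j, u.2).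
Proof.
move=> [[A B] /= [hA hB] AB].
have h1 := @near_location th j _ hA; have h2 := @near_scale th _ hB.
by apply: filterS2 h1 h2 => u uA uB; apply: (AB (_, _)).
Qed.

Lemma near_forall_ord (th : param) (Q : 'I_m -> param -> Prop) :
  (forall j, \forall u \near th, Q j u) -> \forall u \near th, forall j, Q j u.
Proof. by move=> h; exact: (@filter_forall param 'I_m Q (nbhs th) _ h). Qed.

(** On [[-B, B]] kernels and weights are uniformly close to their limits. Beyond [B] the crude bound
    [v0 / sg] is used, with [sg] above half the limit scale. *)
Lemma near_mixdens_le (th : param) (B e : R) :
  (forall j, 0 <= weight th j) -> (forall j, `|location th j| <= 1) ->
  0 < th.2 -> 0 < e ->
  \forall u \near th, forall a p sg, valid_mix a p -> 0 < sg ->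
    u = encode a p sg -> forall x, mixdens f a p sg x <=
      mixlim th x + e + 2 * v0 / th.2 * \1_[set y : R | B < `|y|] x.
Proof.
move=> a0 t1 s0 e0; set s := th.2.
have e2 : 0 < e / 2 by rewrite divr_gt0.
pose M := v0 / s; have M0 : 0 < M by rewrite divr_gt0.
(* [M] bounds the limit kernels; [d] keeps the total effect of the weights, [m] times [d * M],
   within [e / 2]. *)
pose d := e / 2 / (m%:R + 1) / M.
have m1 : 0 < m%:R + 1 :> R by rewrite ltr_wpDl.
have d0 : 0 < d by rewrite !divr_gt0.
have h1 : \forall u \near th, forall j p, location u j = contractR p ->
    forall x, `|x| <= B -> `|locscale f p u.2 x - climit f (location th j) s x| < e / 2.
  apply: near_forall_ord => j.
  have := near_locscale_climit f_ge0 f_cont v1_gt0 beta_gt1 f_le_v1 B (t1 j) s0 e2.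
  by move=> /near_location_scale.
have h2 : \forall u \near th, forall j, `|weight th j - weight u j| < d.
  apply: near_forall_ord => j; apply: (@near_weight th j (fun x => `|weight th j - x| < d)).
  have : x @[x --> weight th j] --> weight th j by exact: cvg_id.
  by move=> /cvgrPdist_lt; exact.
have h3 : \forall u \near th, s / 2 < u.2.
  apply: (@near_scale th (fun x => s / 2 < x)); apply: lt_nbhsr.
  by rewrite ltr_pdivrMr// ltr_pMr// ltr1n.
near=> u => a p sg va sg0 uE x.
have s2 : s / 2 < sg.
  have : s / 2 < u.2 by near: u.
  by rewrite uE.
have lim0 j : 0 <= climit f (location th j) s x.
  by rewrite /climit; case: ifP => // _; rewrite locscale_ge0.
have limM j : climit f (location th j) s x <= M.
  rewrite /climit; case: ifP => _; first exact: locscale_le.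
  exact: ltW.
have G0 : 0 <= mixlim th x by apply: sumr_ge0 => j _; rewrite mulr_ge0.
have [xB|xB] := leP `|x| B; last first.
  rewrite indicE mem_set//= mulr1.
  apply: (@le_trans _ _ (2 * v0 / s)); last by rewrite lerDr addr_ge0// ltW.
  apply: mixdens_le => // j; apply: (le_trans (locscale_le f_le_v0 _ _ sg0)).
  rewrite -(ler_pM2r sg0) divfK ?gt_eqF// mulrAC ler_pdivlMr//.
  have : v0 * (s / 2) < v0 * sg by rewrite ltr_pM2l.
  by lra.
rewrite indicE memNset ?mulr0 ?addr0/=; last by apply/negP; rewrite -leNgt.
have au j : a j = weight u j by rewrite uE /weight /location /= mxE.
have hl j : `|locscale f (p j) sg x - climit f (location th j) s x| < e / 2.
  have H : forall j p, location u j = contractR p ->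
    forall x, `|x| <= B -> `|locscale f p u.2 x - climit f (location th j) s x| < e / 2.
    by near: u.
  have -> : sg = u.2 by rewrite uE.
  by apply: H => //; rewrite uE /location /= mxE.
have ha j : `|weight th j - a j| < d.
  by rewrite au; move: j; near: u.
have [a_ge0 a1] := va.
rewrite /mixdens -lerBlDl /mixlim -sumrB.
apply: (@le_trans _ _ (\sum_j (a j * (e / 2) + d * M))); last first.
  have -> : \sum_j (a j * (e / 2) + d * M) = e / 2 + d * M *+ m.
    by rewrite big_split/= -mulr_suml a1 mul1r sumr_const card_ord.
  have -> : d * M = e / 2 / (m%:R + 1) by rewrite /d mulfVK// gt_eqF.
  rewrite [leRHS]splitr lerD2l -mulr_natr -mulrA ler_piMr ?(ltW e2)//.
  by rewrite mulrC ler_pdivrMr// mul1r lerDl.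
apply: ler_sum => j _.
(* A change of kernel, averaged with the weights [a j] of sum 1, plus a change of weight times a
   kernel bounded by [M]. *)
have -> : a j * locscale f (p j) sg x - weight th j * climit f (location th j) th.2 x =
  a j * (locscale f (p j) sg x - climit f (location th j) s x) +
  (a j - weight th j) * climit f (location th j) s x by rewrite /s; ring.
apply: lerD.
  by rewrite ler_wpM2l//; apply: le_trans (ltW (hl j)); exact: ler_norm.
apply: (@le_trans _ _ (`|weight th j - a j| * climit f (location th j) s x)).
  by rewrite ler_wpM2r// distrC ler_norm.
by rewrite ler_pM// ltW.
Unshelve. all: by end_near. Qed.

Lemma climit_ge0 t s x : 0 < s -> 0 <= climit f t s x.
Proof. by move=> s0; rewrite /climit; case: ifP => // _; rewrite locscale_ge0. Qed.

Lemma mixlim_ge0 (th : param) x : (forall j, 0 <= weight th j) -> 0 < th.2 ->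
  0 <= mixlim th x.
Proof. by move=> a0 s0; apply: sumr_ge0 => j _; rewrite mulr_ge0// climit_ge0. Qed.

Lemma continuous_climit t s : continuous (climit f t s).
Proof.
rewrite /climit; have [t1|t1] := ltP `|t| 1; first exact: continuous_locscale.
by move=> x; exact: cvg_cst.
Qed.

Lemma continuous_mixlim (th : param) : continuous (mixlim th).
Proof.
move=> x; apply: cvg_big => [|j _]; first exact: add_continuous.
by apply: cvgM; [exact: cvg_cst|exact: continuous_climit].
Qed.

Lemma integral_mixlim (th : param) : (\int[mu]_x (f x)%:E = 1)%E ->
  (forall j, 0 <= weight th j) -> 0 < th.2 ->
  (\int[mu]_x (mixlim th x)%:E =
   (\sum_(j | (`|location th j| < 1)) weight th j)%:E)%E.
Proof.
move=> f1 a0 s0.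
have mc j : measurable_fun setT (climit f (location th j) th.2).
  by apply: continuous_measurable_fun; exact: continuous_climit.
under eq_integral do rewrite /mixlim -sumEFin.
rewrite ge0_integral_sum//; first last.
- by move=> j x _; rewrite lee_fin mulr_ge0// climit_ge0.
- by move=> j; apply/measurable_EFinP/measurable_funM => //; exact: mc.
rewrite [in RHS]big_mkcond/= -sumEFin; apply: eq_bigr => j _.
under eq_integral do rewrite EFinM.
rewrite ge0_integralZl//; first last.
- by rewrite lee_fin.
- by move=> x _; rewrite lee_fin climit_ge0.
- by apply/measurable_EFinP; exact: mc.
rewrite /climit; case: ifP => _; last by rewrite integral0 mule0.
by rewrite integral_locscale// f1 mule1.
Qed.

End envelope.

(** The likelihood condition in product form. Positivity of [u] keeps the left-hand sum finite, so a
    nonpositive [v i], which makes the right-hand sum [-oo], contradicts the hypothesis. *)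
Lemma sum_elog_le_prod {R : realType} n (u v : 'I_n -> R) (c : R) :
  (forall i, 0 < u i) ->
  (\sum_i elog (u i) + c%:E <= \sum_i elog (v i))%E ->
  expR c * \prod_i u i <= \prod_i v i.
Proof.
move=> u0.
have -> : (\sum_i elog (u i) = (\sum_i ln (u i))%:E)%E.
  by rewrite -sumEFin; apply: eq_bigr => i _; rewrite /elog u0.
have [v0|/existsNP[i vi]] := pselect (forall i, 0 < v i); last first.
  have -> : (\sum_i elog (v i) = -oo)%E.
    apply/eqP; rewrite esum_eqNy; apply/existsP; exists i.
    by rewrite /elog; case: ifP => // /vi.
  by rewrite -EFinD leeNy_eq.
have -> : (\sum_i elog (v i) = (\sum_i ln (v i))%:E)%E.
  by rewrite -sumEFin; apply: eq_bigr => i _; rewrite /elog v0.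
rewrite -EFinD lee_fin => h.
have -> : expR c * \prod_i u i = expR (\sum_i ln (u i) + c).
  rewrite expRD expR_sum mulrC; congr (_ * _).
  by apply: eq_bigr => i _; rewrite lnK ?posrE.
have -> : \prod_i v i = expR (\sum_i ln (v i)).
  by rewrite expR_sum; apply: eq_bigr => i _; rewrite lnK ?posrE.
by rewrite ler_expR.
Qed.

(** * Existence of good envelopes, and identification of the true parameter *)

Section identification.
Context {R : realType} (m : nat) (f : R -> R) (v0 v1 beta : R).
Local Notation mu := (@lebesgue_measure R).
Hypothesis f_ge0 : forall x, 0 <= f x.
Hypothesis f_cont : continuous f.
Hypothesis v0_gt0 : 0 < v0.
Hypothesis v1_gt0 : 0 < v1.
Hypothesis beta_gt1 : 1 < beta.
Hypothesis f_le_v0 : forall x, f x <= v0.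
Hypothesis f_le_v1 : forall x, x != 0 -> f x <= v1 * `|x| `^ (- beta).
Hypothesis f_int1 : (\int[mu]_x (f x)%:E = 1)%E.
Variables (alpha0 mu0 : 'I_m -> R) (sigma0 : R).
Hypothesis valid0 : valid_mix alpha0 mu0.
Hypothesis sigma0_gt0 : 0 < sigma0.
Local Notation g0 := (mixdens f alpha0 mu0 sigma0).

Let g0_ge0 x : 0 <= g0 x.
Proof. by apply: mixdens_ge0 => //; case: valid0. Qed.

Let g0_meas : measurable_fun setT g0.
Proof. exact: measurable_mixdens. Qed.

Section envelope_existence.
Variable s : R.
Hypothesis s01 : 0 < s < 1.
Hypothesis sbeta : 1 < beta * (1 - s).

Let s_gt0 : 0 < s. Proof. by case/andP: s01. Qed.
Let s_lt1 : s < 1. Proof. by case/andP: s01. Qed.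

Lemma integral_g0_powR : (\int[mu]_x (g0 x `^ (1 - s))%:E =
  (fine (\int[mu]_x (g0 x `^ (1 - s))%:E))%:E)%E.
Proof.
rewrite fineK// ge0_fin_numE.
  apply: (integral_mixdens_powR_lty f_ge0 f_cont v0_gt0 v1_gt0 beta_gt1
    f_le_v0 f_le_v1 valid0 sigma0_gt0) => //.
  by rewrite subr_gt0.
by apply: integral_ge0 => x _; rewrite lee_fin powR_ge0.
Qed.

(** Subadditivity of the power [s] splits the integral for the envelope [G] into three: the one for
    the limit density, equal to [rho < 1], and those for the constant [e] and for the tail beyond
    [B]. Each of the last two is made at most a third of the gap [d = 1 - rho]. *)
Lemma exists_envelope (th : @param R m) :
  (forall j, 0 <= weight th j) -> (forall j, `|location th j| <= 1) -> 0 < th.2 ->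
  (\int[mu]_x (mixlim f th x `^ s * g0 x `^ (1 - s))%:E < 1)%E ->
  exists G : R -> R, [/\ forall x, 0 <= G x, measurable_fun setT G,
    (\int[mu]_x (G x `^ s * g0 x `^ (1 - s))%:E < 1)%E &
    \forall u \near th, forall a p sg, valid_mix a p -> 0 < sg ->
      u = encode a p sg -> forall x, mixdens f a p sg x <= G x].
Proof.
move=> a0 t1 th0; set rho := (X in (X < 1)%E) => rho1.
have rho0 : (0 <= rho)%E.
  by apply: integral_ge0 => x _; rewrite lee_fin mulr_ge0 ?powR_ge0.
have rhoE : rho = (fine rho)%:E.
  by rewrite fineK// ge0_fin_numE//; apply: lt_trans rho1 (ltry _).
pose d := 1 - fine rho.
have d0 : 0 < d by rewrite subr_gt0 -lte_fin -rhoE.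
have I0E := integral_g0_powR; set I0 := fine _ in I0E.
have I0_ge0 : 0 <= I0.
  by apply: fine_ge0; apply: integral_ge0 => x _; rewrite lee_fin powR_ge0.
(* The value wanted for the power [s] of [e]; its product with [I0] is at most [d / 3]. *)
pose es := d / 3 / (I0 + 1); have I1 : 0 < I0 + 1 by rewrite ltr_wpDl.
have es0 : 0 < es by rewrite !divr_gt0.
pose e := es `^ s^-1; have e0 : 0 < e by rewrite powR_gt0.
have eE : e `^ s = es by rewrite /e -powRrM mulVf ?gt_eqF// powRr1// ltW.
pose M := 2 * v0 / th.2; have M0 : 0 < M by rewrite divr_gt0// mulr_gt0.
have Ms0 : 0 < M `^ s by rewrite powR_gt0.
have mgs : measurable_fun setT (fun x => g0 x `^ (1 - s)).
  exact: (measurableT_comp (@measurable_powR R _)).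
have gs0 x : 0 <= g0 x `^ (1 - s) by rewrite powR_ge0.
have gsoo : (\int[mu]_x (g0 x `^ (1 - s))%:E < +oo)%E by rewrite I0E ltry.
(* The tail of the integral beyond [B] must stay below [d / 3] after multiplication by the power [s]
   of [M]. *)
have dM0 : 0 < d / 3 / M `^ s by rewrite !divr_gt0.
have [B B0 hB] := integral_tail_lt gs0 mgs gsoo dM0.
pose chi := \1_[set y : R | B < `|y|] : R -> R.
have mB := measurable_norm_gt B.
have mchi : measurable_fun setT chi by exact: measurable_indic.
have chi0 x : 0 <= chi x by rewrite /chi indicE.
have chis x : chi x `^ s = chi x.
  by rewrite /chi indicE; case: (_ \in _); rewrite ?powR1 ?powR0// gt_eqF.
have ml0 x : 0 <= mixlim f th x by exact: mixlim_ge0.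
have mml : measurable_fun setT (mixlim f th).
  by apply: continuous_measurable_fun; exact: continuous_mixlim.
pose G x := mixlim f th x + e + M * chi x.
have mG : measurable_fun setT G.
  by apply: measurable_funD; [exact: measurable_funD|exact: measurable_funM].
have mGJ : measurable_fun setT (fun x => (G x `^ s * g0 x `^ (1 - s))%:E).
  by apply/measurable_EFinP; exact: measurable_powR_prod.
have mlJ : measurable_fun setT (fun x => (mixlim f th x `^ s * g0 x `^ (1 - s))%:E).
  by apply/measurable_EFinP; exact: measurable_powR_prod.
exists G; split; [|exact: mG| |].
- by move=> x; exact: (addr_ge0 (addr_ge0 (ml0 x) (ltW e0)) (mulr_ge0 (ltW M0) (chi0 x))).
- apply: (@le_lt_trans _ _ (\int[mu]_x ((mixlim f th x `^ s * g0 x `^ (1 - s))%:E +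
     (es%:E * (g0 x `^ (1 - s))%:E + (M `^ s)%:E * (g0 x `^ (1 - s) * chi x)%:E)))%E).
    apply: ge0_le_integral => //.
    + by move=> x _; rewrite lee_fin mulr_ge0 ?powR_ge0.
    + apply: emeasurable_funD => //.
      apply: emeasurable_funD; apply: emeasurable_funM => //; apply/measurable_EFinP => //.
      exact: measurable_funM.
    + move=> x _; rewrite -!EFinM -!EFinD lee_fin.
      have -> : es * g0 x `^ (1 - s) + M `^ s * (g0 x `^ (1 - s) * chi x) =
        (es + M `^ s * chi x) * g0 x `^ (1 - s) by ring.
      rewrite -mulrDl ler_wpM2r ?powR_ge0//.
      apply: (le_trans (powR_subadditive _ _ _)).
      * by rewrite s_gt0 ltW.
      * by rewrite addr_ge0// ltW.
      * by rewrite mulr_ge0// ltW.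
      rewrite addrA lerD//; last by rewrite powRM ?chis// ltW.
      by rewrite -eE; apply: powR_subadditive; rewrite ?s_gt0 ?(ltW s_lt1) ?(ltW e0).
  have p1 x : (0 <= (mixlim f th x `^ s * g0 x `^ (1 - s))%:E)%E.
    by rewrite lee_fin mulr_ge0 ?powR_ge0.
  have p2 x : (0 <= es%:E * (g0 x `^ (1 - s))%:E)%E.
    by rewrite -EFinM lee_fin mulr_ge0 ?powR_ge0// ltW.
  have p3 x : (0 <= (M `^ s)%:E * (g0 x `^ (1 - s) * chi x)%:E)%E.
    by rewrite -EFinM lee_fin !mulr_ge0 ?powR_ge0// ltW.
  have m2 : measurable_fun setT (fun x => es%:E * (g0 x `^ (1 - s))%:E)%E.
    by apply: emeasurable_funM => //; exact/measurable_EFinP.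
  have m3' : measurable_fun setT (fun x => (g0 x `^ (1 - s) * chi x)%:E)%E.
    by apply/measurable_EFinP; exact: measurable_funM.
  have m3 : measurable_fun setT (fun x => (M `^ s)%:E * (g0 x `^ (1 - s) * chi x)%:E)%E.
    by apply: emeasurable_funM.
  rewrite ge0_integralD//; first last.
  + by apply: emeasurable_funD.
  + by move=> x _; rewrite adde_ge0.
  rewrite -/rho ge0_integralD//.
  have -> : (\int[mu]_x (es%:E * (g0 x `^ (1 - s))%:E) = (es * I0)%:E)%E.
    rewrite ge0_integralZl ?I0E//; last by rewrite lee_fin ltW.
      exact/measurable_EFinP.
    by move=> x _; rewrite lee_fin.
  have -> : (\int[mu]_x ((M `^ s)%:E * (g0 x `^ (1 - s) * chi x)%:E) =
      (M `^ s)%:E * \int[mu]_x (g0 x `^ (1 - s) * chi x)%:E)%E.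
    rewrite ge0_integralZl//; last by rewrite lee_fin ltW.
    by move=> x _; rewrite lee_fin mulr_ge0.
  have h1 : es * I0 <= d / 3.
    rewrite /es -mulrA ler_piMr ?divr_ge0 ?(ltW d0)//.
    by rewrite mulrC ler_pdivrMr// mul1r lerDl.
  move: hB; rewrite -/chi; set tail := (X in (X < _)%E) => hB.
  have tail0 : (0 <= tail)%E.
    by apply: integral_ge0 => x _; rewrite lee_fin mulr_ge0.
  have tailE : tail = (fine tail)%:E.
    by rewrite fineK// ge0_fin_numE//; apply: lt_trans hB (ltry _).
  have h2 : M `^ s * fine tail < d / 3.
    by rewrite mulrC -ltr_pdivlMr// -lte_fin -tailE.
  have -> : (\int[mu]_x (g0 x `^ (1 - s) * chi x)%:E = (fine tail)%:E)%E by exact: tailE.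
  rewrite rhoE -EFinM -!EFinD lte_fin.
  by move: h1 h2 d0; rewrite /d; lra.
- exact: (near_mixdens_le f_ge0 f_cont v0_gt0 v1_gt0 beta_gt1 f_le_v0 f_le_v1 B a0 t1 th0 e0).
Qed.

End envelope_existence.

Hypothesis identifiable : forall (a1 m1 a2 m2 : 'I_m -> R) (s1 s2 : R),
  valid_mix a1 m1 -> valid_mix a2 m2 -> 0 < s1 -> 0 < s2 ->
  (forall x, mixdens f a1 m1 s1 x = mixdens f a2 m2 s2 x) ->
  (forall t, mixCDF a1 m1 t = mixCDF a2 m2 t) /\ s1 = s2.
Hypothesis g0_int1 : (\int[mu]_x (g0 x)%:E = 1)%E.

(** As [g0] has mass 1, no weight can sit at infinity. The limit density is then a genuine mixture
    with the decoded locations, and (C1) applies to it. *)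
Lemma mixlim_identified (th : @param R m) :
  (forall j, 0 <= weight th j) -> \sum_j weight th j = 1 -> 0 < th.2 ->
  (forall x, mixlim f th x = g0 x) ->
  [/\ forall t, mixCDF (weight th) (expandR \o location th) t = mixCDF alpha0 mu0 t,
      th.2 = sigma0 & forall j, 1 <= `|location th j| -> weight th j = 0].
Proof.
move=> a0 a1 th0 eqg.
have near1 : \sum_(j | `|location th j| < 1) weight th j = 1.
  apply: EFin_inj; rewrite -(integral_mixlim f_ge0 f_cont f_int1 a0 th0) -[RHS]g0_int1.
  by apply: eq_integral => x _; rewrite eqg.
have far0 : \sum_(j | ~~ (`|location th j| < 1)) weight th j = 0.
  by move: a1; rewrite (bigID (fun j => `|location th j| < 1))/= near1; lra.
have far j : 1 <= `|location th j| -> weight th j = 0.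
  move=> tj; apply: (psumr_eq0P _ far0) => //; by rewrite -leNgt.
(* An infinite location is decoded to an arbitrary finite one, which is harmless because its weight
   is 0. *)
have vth : valid_mix (weight th) (expandR \o location th) by split.
have eqd x : mixdens f (weight th) (expandR \o location th) th.2 x = g0 x.
  rewrite -eqg; apply: eq_bigr => j _; rewrite /climit /=.
  by have [//|/far ->] := ltP `|location th j| 1; rewrite !mul0r.
by have [] := identifiable vth valid0 th0 sigma0_gt0 eqd.
Qed.

(** Equal distribution functions need not have equal coordinates, as support points may be permuted
    or repeated. So in [Dist] the true mixing distribution is first replaced by the decoded limit
    parameter, to which the nearby parameters are close coordinate by coordinate. *)
Lemma near_identified (th : @param R m) (e : R) :
  (forall j, 0 <= weight th j) -> \sum_j weight th j = 1 ->
  (forall j, `|location th j| <= 1) -> 0 < th.2 ->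
  (forall x, mixlim f th x = g0 x) -> 0 < e ->
  \forall u \near th, forall a p sg, u = encode a p sg ->
    (Dist a p alpha0 mu0 < e%:E)%E /\ `|sg - sigma0| < e.
Proof.
move=> a0 a1 t1 th0 eqg e0.
have [cdfE sE far] := mixlim_identified a0 a1 th0 eqg.
pose C := fine (\int[mu]_x (expR (- `|x|))%:E)%E.
have CE : (\int[mu]_x (expR (- `|x|))%:E <= C%:E)%E.
  rewrite fineK// ge0_fin_numE; first exact: integral_expRN_norm_lty.
  by apply: integral_ge0 => x _; rewrite lee_fin expR_ge0.
have C0 : 0 <= C by apply: fine_ge0; apply: integral_ge0 => x _; rewrite lee_fin expR_ge0.
(* [k] is such that the final bound [m d C + d] equals [e / 2]. *)
pose k := m%:R * C + 1; have k0 : 0 < k by rewrite ltr_wpDl// mulr_ge0.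
pose d := e / 2 / k; have d0 : 0 < d by rewrite !divr_gt0.
have h1 : \forall u \near th, forall j p, location u j = contractR p ->
    `|location th j| < 1 -> `|p - expandR (location th j)| < d.
  apply: near_forall_ord => j.
  apply: (@near_location _ _ th j (fun t => forall p, t = contractR p ->
    `|location th j| < 1 -> `|p - expandR (location th j)| < d)).
  have [tj|tj] := ltP `|location th j| 1; last by near=> t.
  have := near_contractR_expandR tj d0.
  by apply: filterS => t ht p tp _; exact: ht.
have h2 : \forall u \near th, forall j, `|weight th j - weight u j| < d.
  apply: near_forall_ord => j.
  apply: (@near_weight _ _ th j (fun x => `|weight th j - x| < d)).
  have : x @[x --> weight th j] --> weight th j by exact: cvg_id.
  by move=> /cvgrPdist_lt; exact.
have h3 : \forall u \near th, `|th.2 - u.2| < e.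
  apply: (@near_scale _ _ th (fun x => `|th.2 - x| < e)).
  have : x @[x --> th.2] --> th.2 by exact: cvg_id.
  by move=> /cvgrPdist_lt; exact.
near=> u => a p sg uE; split; last first.
  rewrite -sE distrC (_ : sg = u.2) ?uE//; rewrite -?uE; by near: u.
have -> : Dist a p alpha0 mu0 = Dist a p (weight th) (expandR \o location th).
  by apply: eq_integral => t _; rewrite cdfE.
apply: (le_lt_trans (Dist_le _ _ _ CE a0)); rewrite lte_fin.
apply: (@le_lt_trans _ _ (\sum_j (d * C + weight th j * d))).
  apply: ler_sum => j _; apply: lerD.
    rewrite ler_wpM2r// distrC ltW// (_ : a j = weight u j); last by rewrite uE /weight mxE.
    by move: j; near: u.
  have [tj|/far ->] := ltP `|location th j| 1; last by rewrite !mul0r.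
  rewrite ler_wpM2l// ltW//.
  have H : forall j p, location u j = contractR p ->
    `|location th j| < 1 -> `|p - expandR (location th j)| < d by near: u.
  by apply: H => //; rewrite uE /location mxE.
rewrite big_split/= sumr_const card_ord -mulr_suml a1 mul1r -mulr_natr.
have -> : d * C * m%:R + d = e / 2 by rewrite /d /k; field; rewrite gt_eqF.
by rewrite ltr_pdivrMr// ltr_pMr// ltr1n.
Unshelve. all: by end_near. Qed.

End identification.

(** * The filter of almost sure eventual events *)

Section ae_eventually.
Context d (T : measurableType d) (R : realType) (P : probability T R).

(** A filter on pairs of an outcome and a sample size, so that such statements combine under
    [filterS2] and can index a covering argument over a compact set. *)
Definition ae_eventually : set_system (T * nat) :=
  [set A | {ae P, forall w, \forall n \near \oo, A (w, n)}].

Global Instance ae_eventually_filter : Filter ae_eventually.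
Proof.
split.
- by apply: aeW => w; exact: nearW.
- move=> A B; rewrite /ae_eventually /= => hA hB; apply: filterS2 hA hB => w hA hB.
  by apply: filterS2 hA hB => n.
- move=> A B AB; rewrite /ae_eventually /=; apply: filterS => w.
  by apply: filterS => n; exact: AB.
Qed.

End ae_eventually.

Lemma prodr_powR {R : realType} n (u : 'I_n -> R) (p : R) :
  (forall i, 0 <= u i) -> \prod_i (u i `^ p) = (\prod_i u i) `^ p.
Proof.
elim: n u => [|n IHn] u u0; first by rewrite !big_ord0 powR1.
rewrite !big_ord_recl IHn// powRM// prodr_ge0//.
Qed.

(** * Almost sure bounds on likelihood products *)

Section likelihood.
Context d (T : measurableType d) {R : realType} (P : probability T R).
Variables (X : nat -> T -> R) (m : nat) (f : R -> R) (v0 v1 beta : R).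
Local Notation mu := (@lebesgue_measure R).
Hypothesis f_ge0 : forall x, 0 <= f x.
Hypothesis f_cont : continuous f.
Hypothesis v0_gt0 : 0 < v0.
Hypothesis v1_gt0 : 0 < v1.
Hypothesis beta_gt1 : 1 < beta.
Hypothesis f_le_v0 : forall x, f x <= v0.
Hypothesis f_le_v1 : forall x, x != 0 -> f x <= v1 * `|x| `^ (- beta).
Variables (alpha0 mu0 : 'I_m -> R) (sigma0 : R).
Hypothesis valid0 : valid_mix alpha0 mu0.
Hypothesis sigma0_gt0 : 0 < sigma0.
Local Notation g0 := (mixdens f alpha0 mu0 sigma0).
Hypothesis X_meas : forall i, measurable_fun [set: T] (X i).
Hypothesis X_law : forall i (A : set R), measurable A ->
  P (X i @^-1` A) = (\int[mu]_(x in A) (g0 x)%:E)%E.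
Hypothesis X_indep : mutually_independent P X.
Variable s : R.
Hypothesis s01 : 0 < s < 1.
Hypothesis sbeta : 1 < beta * (1 - s).
Variable c : R.

Let s_gt0 : 0 < s. Proof. by case/andP: s01. Qed.
Let s_lt1 : s < 1. Proof. by case/andP: s01. Qed.

Let g0_ge0 x : 0 <= g0 x.
Proof. by apply: mixdens_ge0 => //; case: valid0. Qed.

Let g0_meas : measurable_fun setT g0.
Proof. exact: measurable_mixdens. Qed.

Lemma integral_density1 : (\int[mu]_x (g0 x)%:E = 1)%E.
Proof. by rewrite -(X_law 0 measurableT) preimage_setT probability_setT. Qed.

(** The zero set of [g0] has probability 0 under the law of each [X i], and countably many null sets
    have a null union. *)
Lemma ae_density_gt0 : {ae P, forall w, forall i, 0 < g0 (X i w)}.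
Proof.
apply: ae_foralln => i; pose A := g0 @^-1` [set 0].
have mA : measurable A by rewrite -[A]setTI; exact: g0_meas.
exists (X i @^-1` A); split.
- rewrite -[X in measurable X]setTI; exact: X_meas.
- transitivity (\int[mu]_(x in A) (g0 x)%:E)%E; first exact: X_law.
  by apply: integral0_eq => x Ax; rewrite Ax.
- move=> w /= /negP; rewrite -leNgt => le0.
  by apply/eqP; rewrite eq_le le0 g0_ge0.
Qed.

(** The Chernoff bound for the power [s] of [G / g0], whose mean is the given integral. The level
    [expR (s * c)] becomes the factor [expR c] after an [s]-th root. *)
Lemma prod_envelope_lt (G : R -> R) :
  (forall x, 0 <= G x) -> measurable_fun setT G ->
  (\int[mu]_x (G x `^ s * g0 x `^ (1 - s))%:E < 1)%E ->
  ae_eventually P [set q | \prod_(i < q.2) G (X i q.1) <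
                           expR c * \prod_(i < q.2) g0 (X i q.1)].
Proof.
move=> G0 mG; set rho := (X in (X < 1)%E) => rho1.
have rho0 : (0 <= rho)%E.
  by apply: integral_ge0 => x _; rewrite lee_fin mulr_ge0 ?powR_ge0.
have rhof : rho = (fine rho)%:E.
  by rewrite fineK// ge0_fin_numE//; apply: lt_trans rho1 (ltry _).
pose Z x := G x `^ s * g0 x `^ (- s).
have Z0 x : 0 <= Z x by rewrite mulr_ge0 ?powR_ge0.
have mZ : measurable_fun setT Z by exact: measurable_powR_prod.
have rhoE : (\int[mu]_x (Z x * g0 x)%:E = (fine rho)%:E)%E.
  rewrite -rhof; apply: eq_integral => x _; congr EFin.
  rewrite /Z -mulrA; congr (_ * _).
  (* Where [g0] vanishes both sides are 0, because [1 - s] is not 0. *)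
  have := g0_ge0 x; rewrite le0r => /predU1P[->|g0x].
    by rewrite mulr0 powR0// subr_eq0 gt_eqF.
  by rewrite -{2}[g0 x]powRr1 ?ltW// -powRD ?(gt_eqF g0x) ?implybT// addrC.
have fr1 : fine rho < 1 by rewrite -lte_fin -rhof.
have := prod_iid_eventually_lt X_meas g0_ge0 g0_meas X_law X_indep Z0 mZ rhoE
  (expR_gt0 (s * c)) fr1.
move=> ae1; apply: filterS2 ae1 ae_density_gt0 => w ev gpos; apply: filterS ev => n /=.
have Q0 : 0 < \prod_(i < n) g0 (X i w) by exact: prodr_gt0.
rewrite /Z big_split/= !prodr_powR//.
rewrite powRN ltr_pdivrMr ?powR_gt0// => h; rewrite ltNge; apply/negP => hle.
move: h; apply/negP; rewrite -leNgt.
have -> : expR (s * c) = expR c `^ s by rewrite /powR gt_eqF ?expR_gt0// expRK.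
rewrite -powRM ?expR_ge0 ?(ltW Q0)//.
apply: ge0_ler_powR => //; rewrite ?nnegrE ?(ltW s_gt0) ?prodr_ge0//.
by rewrite mulr_ge0 ?expR_ge0 ?ltW.
Qed.

(** A constant envelope [D], so small that its power [s] times the integral [I0] is below 1. It
    serves against both large and vanishing scales. *)
Lemma likelihood_lower_bound : exists2 D : R, 0 < D &
  ae_eventually P [set q | D ^+ q.2 < expR c * \prod_(i < q.2) g0 (X i q.1)].
Proof.
have I0E := integral_g0_powR f_ge0 f_cont v0_gt0 v1_gt0 beta_gt1 f_le_v0 f_le_v1
  valid0 sigma0_gt0 s01 sbeta.
set I0 := fine _ in I0E.
have I0_ge0 : 0 <= I0.
  by apply: fine_ge0; apply: integral_ge0 => x _; rewrite lee_fin powR_ge0.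
have I1 : 0 < I0 + 1 by rewrite ltr_wpDl.
pose D := (I0 + 1)^-1 `^ s^-1.
have D0 : 0 < D by rewrite powR_gt0// invr_gt0.
have Ds : D `^ s = (I0 + 1)^-1.
  by rewrite /D -powRrM mulVf ?gt_eqF// powRr1// invr_ge0 ltW.
exists D => //.
have := @prod_envelope_lt (cst D) _ _ _.
rewrite /=; under eq_set do rewrite prodr_const card_ord.
apply => //; first by move=> _; exact: ltW.
under eq_integral do rewrite Ds EFinM.
rewrite ge0_integralZl//; first last.
- by rewrite lee_fin invr_ge0 ltW.
- by move=> x _; rewrite lee_fin powR_ge0.
- by apply/measurable_EFinP; exact: (measurableT_comp (@measurable_powR R _)).
rewrite I0E -EFinM lte_fin mulrC ltr_pdivrMr// mul1r; lra.
Qed.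

(** An observation in some exceptional set [Bs j] scores 1, any other scores [- 2 b]. A Chernoff
    bound keeps the total score below [- b n]. Each density value is at most [C] times [sg] to the
    power of minus the score, so the product is at most the [n]-th power of [C] times [sg] to the
    power [b], which is small with [sg]. *)
Lemma small_scale (th : @param R m) (D : R) :
  0 < D -> (forall j, `|location th j| <= 1) -> th.2 = 0 ->
  \forall u \near th & q \near ae_eventually P, forall a p sg,
    valid_mix a p -> 0 < sg -> u = encode a p sg ->
    \prod_(i < q.2) mixdens f a p sg (X i q.1) <= D ^+ q.2.
Proof.
(* Away from its locations the density is of order [sg] to the power [beta - 1 = 2 b]; half of this
   exponent is left to compensate the observations near them. *)
move=> D0 t1 th0; pose b := (beta - 1) / 2.
have b0 : 0 < b by rewrite divr_gt0// subr_gt0.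
have eb1 : expR (- b) < 1 by rewrite expR_lt1 oppr_lt0.
have m1 : 0 < m%:R + 1 :> R by rewrite ltr_wpDl.
(* [eta] bounds the mass of each exceptional set; [m] of them leave the mean of [Z] below 1. *)
pose eta := (1 - expR (- b)) / (m%:R + 1) / expR (1 + b).
have eta0 : 0 < eta by rewrite !divr_gt0 ?expR_gt0 ?subr_gt0.
pose M := v0 / sigma0; have M0 : 0 < M by rewrite divr_gt0.
have g0M x : g0 x <= M by apply: mixdens_le => // j; exact: locscale_le.
(* An interval of length [4 * dl] has mass at most [M * 4 * dl = eta]. *)
pose dl := eta / (4 * M); have dl0 : 0 < dl by rewrite divr_gt0// mulr_gt0.
have g0oo : (\int[mu]_x (g0 x)%:E < +oo)%E by rewrite integral_density1 ltry.
have [A A0 hA] := integral_tail_lt g0_ge0 g0_meas g0oo eta0.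
pose ctr j := expandR (location th j).
(* The half-width is [2 * dl] while the location will move by less than [dl], so a point outside
   stays at distance at least [dl] from the actual location. For an infinite limit the set is a far
   tail. *)
pose Bs j : set R := if `|location th j| < 1
  then `](ctr j - 2 * dl), (ctr j + 2 * dl)[%classic else [set x | A < `|x|].
have mBs j : measurable (Bs j).
  by rewrite /Bs; case: ifP => _ //; exact: measurable_norm_gt.
have iBs j : (\int[mu]_x (\1_(Bs j) x * g0 x)%:E <= eta%:E)%E.
  rewrite /Bs; case: ifP => _; last first.
    by apply: ltW; under eq_integral do rewrite mulrC.
  apply: (@le_trans _ _ (\int[mu]_x (M%:E *
      (\1_(`](ctr j - 2 * dl), (ctr j + 2 * dl)[%classic : set R) x)%:E))%E).
    apply: ge0_le_integral => //.
    - by move=> x _; rewrite lee_fin mulr_ge0.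
    - by apply/measurable_EFinP/measurable_funM => //; exact: measurable_indic.
    - apply: emeasurable_funM => //; apply/measurable_EFinP; exact: measurable_indic.
    - by move=> x _; rewrite -EFinM lee_fin mulrC ler_wpM2r.
  rewrite ge0_integralZl//; first last.
  - by rewrite lee_fin ltW.
  - by apply/measurable_EFinP; exact: measurable_indic.
  rewrite integral_indic//= setIT.
  rewrite (lebesgue_measure_itv `](ctr j - 2 * dl), (ctr j + 2 * dl)[)/=.
  rewrite lte_fin ifT; last by lra.
  rewrite -EFinB -EFinM lee_fin /dl le_eqVlt; apply/orP; left; apply/eqP.
  by field; rewrite gt_eqF.
(* Bounding the indicator of the union by the sum of the indicators, [Z] dominates the exponential
   of the score plus [b]. *)
pose Z x := expR (- b) + expR (1 + b) * \sum_j \1_(Bs j) x : R.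
have mI j : measurable_fun setT (\1_(Bs j) : R -> R) by exact: measurable_indic.
have sI0 x : 0 <= \sum_j \1_(Bs j) x :> R by apply: sumr_ge0.
have Z0 x : 0 <= Z x by rewrite addr_ge0 ?mulr_ge0 ?expR_ge0.
have mZ : measurable_fun setT Z.
  apply: measurable_funD => //; apply: measurable_funM => //.
  by apply: measurable_sum => j; exact: mI.
have iZ : (\int[mu]_x (Z x * g0 x)%:E < 1)%E.
  have -> : (\int[mu]_x (Z x * g0 x)%:E = \int[mu]_x ((expR (- b))%:E * (g0 x)%:E +
      (expR (1 + b))%:E * \sum_j (\1_(Bs j) x * g0 x)%:E))%E.
    apply: eq_integral => x _; rewrite sumEFin -!EFinM -EFinD /Z mulrDl -mulr_suml.
    by rewrite mulrA.
  have ms : measurable_fun setT (fun x => (\sum_j (\1_(Bs j) x * g0 x)%:E)%E).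
    apply: emeasurable_sum => j; apply/measurable_EFinP; apply: measurable_funM => //.
  have s0 x : (0 <= \sum_j (\1_(Bs j) x * g0 x)%:E)%E.
    by apply: sume_ge0 => j _; rewrite lee_fin mulr_ge0.
  rewrite ge0_integralD//; first last.
  - by apply: emeasurable_funM.
  - by move=> x _; rewrite mule_ge0// lee_fin expR_ge0.
  - by apply: emeasurable_funM => //; exact/measurable_EFinP.
  - by move=> x _; rewrite -EFinM lee_fin mulr_ge0 ?expR_ge0.
  have -> : (\int[mu]_x ((expR (- b))%:E * (g0 x)%:E) = (expR (- b))%:E)%E.
    rewrite ge0_integralZl//; first last.
    - by move=> x _; rewrite lee_fin.
    - exact/measurable_EFinP.
    by rewrite integral_density1 mule1.
  have -> : (\int[mu]_x ((expR (1 + b))%:E * \sum_j (\1_(Bs j) x * g0 x)%:E) =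
      (expR (1 + b))%:E * \sum_j \int[mu]_x (\1_(Bs j) x * g0 x)%:E)%E.
    rewrite ge0_integralZl//; congr (_ * _)%E; rewrite ge0_integral_sum//.
    - by move=> j; apply/measurable_EFinP; apply: measurable_funM => //; exact: mI.
    - by move=> j x _; rewrite lee_fin mulr_ge0.
  apply: (@le_lt_trans _ _ ((expR (- b))%:E + (expR (1 + b))%:E * (m%:R * eta)%:E)%E).
    apply: leeD => //; apply: lee_wpmul2l; first by rewrite lee_fin expR_ge0.
    apply: (@le_trans _ _ (\sum_(j < m) eta%:E)%E); first by apply: lee_sum => j _.
    by rewrite sumEFin sumr_const card_ord mulr_natl.
  rewrite -EFinM -EFinD lte_fin -ltrBrDl.
  have -> : expR (1 + b) * (m%:R * eta) = (1 - expR (- b)) * (m%:R / (m%:R + 1)).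
    by rewrite /eta; field; rewrite !gt_eqF ?expR_gt0.
  by rewrite gtr_pMr ?subr_gt0// ltr_pdivrMr// mul1r ltrDl.
have iZ0 : (0 <= \int[mu]_x (Z x * g0 x)%:E)%E.
  by apply: integral_ge0 => x _; rewrite lee_fin mulr_ge0.
have iZE : (\int[mu]_x (Z x * g0 x)%:E = (fine (\int[mu]_x (Z x * g0 x)%:E))%:E)%E.
  by rewrite fineK// ge0_fin_numE//; apply: lt_trans iZ (ltry _).
have fZ1 : fine (\int[mu]_x (Z x * g0 x)%:E)%E < 1 by rewrite -lte_fin -iZE.
have evZ := prod_iid_eventually_lt X_meas g0_ge0 g0_meas X_law X_indep Z0 mZ iZE
  (@ltr01 R) fZ1.
(* The term [v0] serves inside the exceptional sets, the other at distance at least [dl] from all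
   locations. *)
pose C := v0 + v1 * dl `^ (- beta).
have C0 : 0 < C by rewrite addr_gt0// mulr_gt0// powR_gt0.
(* The minimum with 0 makes [ln sg] negative; the second bound makes the power [b] of [sg] smaller
   than [D / C]. *)
pose tau := expR (Num.min 0 (ln (D / C) / b)).
have tau0 : 0 < tau by exact: expR_gt0.
have h1 : \forall u \near th, forall j p, location u j = contractR p ->
    if `|location th j| < 1 then `|p - ctr j| < dl else A + dl < `|p|.
  apply: near_forall_ord => j.
  apply: (@near_location _ _ th j (fun t => forall p, t = contractR p ->
    if `|location th j| < 1 then `|p - ctr j| < dl else A + dl < `|p|)).
  have [tj|tj] := ltP `|location th j| 1.
    exact: near_contractR_expandR.
  by apply: near_contractR_far; apply/eqP; rewrite eq_le t1 tj.
have h2 : \forall u \near th, u.2 < tau.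
  apply: (@near_scale _ _ th (fun x => x < tau)); rewrite th0; exact: lt_nbhsl.
have h12 : \forall u \near th, u.2 < tau /\ forall j p, location u j = contractR p ->
    if `|location th j| < 1 then `|p - ctr j| < dl else A + dl < `|p|.
  by apply: filterS2 h2 h1 => u.
(* The event involves [Z] only, so a single event serves every parameter in the neighbourhood. *)
exists ([set u | u.2 < tau /\ forall j p, location u j = contractR p ->
    if `|location th j| < 1 then `|p - ctr j| < dl else A + dl < `|p|],
  [set q | \prod_(i < q.2) Z (X i q.1) < 1]) => //=.
move=> [u [w n]] /= [[u2 uloc] Zlt] a p sg va sg0 uE.
have sgt : sg < tau by rewrite uE in u2.
have lsg : ln sg < Num.min 0 (ln (D / C) / b) by rewrite -ltr_expR lnK ?posrE.
have lsg0 : ln sg < 0 by move: lsg; rewrite lt_min => /andP[].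
have lsgD : ln sg * b < ln (D / C).
  by move: lsg; rewrite lt_min => /andP[_]; rewrite ltr_pdivlMr.
pose inB x := [exists j, x \in Bs j].
pose e x : R := if inB x then 1 else - (2 * b).
have eZ x : expR (e x + b) <= Z x.
  rewrite /e /Z /inB; case: ifPn => [/existsP[j xj]|_].
    apply: (@le_trans _ _ (expR (1 + b) * \sum_j \1_(Bs j) x)); last first.
      by rewrite lerDr expR_ge0.
    rewrite ler_peMr ?expR_ge0// (bigD1 j)//= indicE xj lerDl.
    by apply: sumr_ge0.
  have -> : - (2 * b) + b = - b by ring.
  by rewrite lerDl mulr_ge0 ?expR_ge0.
(* Since the product of the [Z (X i w)] is below 1, the scores shifted by [b] have a negative
   sum. *)
have sume : \sum_(i < n) e (X i w) <= - (b * n%:R).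
  have : \prod_(i < n) expR (e (X i w) + b) < 1.
    by apply: le_lt_trans Zlt; apply: ler_prod => i _; rewrite expR_ge0 eZ.
  rewrite -expR_sum expR_lt1 big_split/= sumr_const card_ord -mulr_natr; lra.
have dens x : mixdens f a p sg x <= C * expR (- ln sg * e x).
  apply: mixdens_le => // j; rewrite /e; case: ifPn => [_|xB].
    rewrite mulr1 expRN lnK ?posrE//.
    apply: (le_trans (locscale_le f_le_v0 _ _ sg0)).
    by rewrite ler_wpM2r ?invr_ge0 ?(ltW sg0)// lerDl mulr_ge0 ?powR_ge0 ?ltW.
  have pj : dl <= `|x - p j|.
    have := uloc j (p j); rewrite uE /location /= mxE => /(_ erefl).
    move: xB; rewrite negb_exists => /forallP/(_ j); rewrite notin_setE /Bs.
    case: ifP => _ /=.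
      rewrite in_itv/= => /negP; rewrite -ltr_distl -leNgt => h h'.
      have := ler_distD (p j) x (ctr j); lra.
    move=> /negP; rewrite -leNgt => h h'.
    have := lerB_dist (p j) x; rewrite distrC; lra.
  have x0 : 0 < `|x - p j| by exact: lt_le_trans pj.
  have y0 : (x - p j) / sg != 0.
    have xp : x - p j != 0 by rewrite -normr_gt0.
    by rewrite mulf_neq0// invr_eq0 gt_eqF.
  rewrite /locscale; apply: (@le_trans _ _ (sg^-1 * (v1 * (dl / sg) `^ (- beta)))).
    rewrite ler_wpM2l ?invr_ge0 ?(ltW sg0)//; apply: (le_trans (f_le_v1 y0)).
    rewrite ler_wpM2l ?(ltW v1_gt0)//; apply: le_powRN.
    - by rewrite ltW// (lt_trans _ beta_gt1).
    - by rewrite divr_gt0.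
    - by rewrite normrM normfV (gtr0_norm sg0) ler_wpM2r// invr_ge0 ltW.
  have -> : (dl / sg) `^ (- beta) = dl `^ (- beta) * sg `^ beta.
    rewrite powRM ?invr_ge0 ?ltW//; congr (_ * _).
    by rewrite -[sg^-1]powR_inv1 ?ltW// -powRrM mulrNN mul1r.
  have -> : expR (- ln sg * - (2 * b)) = sg^-1 * sg `^ beta.
    rewrite -powR_inv1 ?(ltW sg0)// -powRD ?(gt_eqF sg0) ?implybT//.
    by rewrite /powR gt_eqF//; congr expR; rewrite /b; field.
  rewrite (_ : sg^-1 * _ = v1 * dl `^ (- beta) * (sg^-1 * sg `^ beta)); last by ring.
  rewrite ler_wpM2r//.
    by rewrite mulr_ge0 ?invr_ge0 ?powR_ge0 ?ltW.
  by rewrite lerDr ltW.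
apply: (@le_trans _ _ (\prod_(i < n) (C * expR (- ln sg * e (X i w))))).
  by apply: ler_prod => i _; rewrite dens mixdens_ge0//; case: va.
rewrite big_split/= prodr_const card_ord -expR_sum -mulr_sumr.
apply: (@le_trans _ _ (C ^+ n * expR (ln sg * b * n%:R))).
  rewrite ler_wpM2l ?exprn_ge0 ?(ltW C0)// ler_expR.
  have : - ln sg * \sum_(i < n) e (X i w) <= - ln sg * - (b * n%:R).
    by rewrite ler_wpM2l// oppr_ge0 ltW.
  by rewrite mulrNN mulrA.
rewrite expRM_natr -exprMn lerXn2r ?nnegrE ?(ltW D0) ?mulr_ge0 ?expR_ge0 ?(ltW C0)//.
rewrite mulrC -ler_pdivlMr// -[leRHS]lnK ?posrE ?divr_gt0// ler_expR.
exact: ltW.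
Qed.

End likelihood.

(** * Compactness of the parameter box and the covering argument *)

Lemma compact_param_box (R : realType) (m : nat) (S : R) :
  compact [set th : @param R m | [/\ forall j, 0 <= weight th j <= 1,
    forall j, `|location th j| <= 1 & 0 <= th.2 <= S]].
Proof.
have c01 : compact [set v : 'rV[R]_m | forall i, `[0, 1]%classic (v ord0 i)].
  by apply: (@rV_compact R m (fun=> `[0, 1]%classic)) => i; exact: segment_compact.
have c11 : compact [set v : 'rV[R]_m | forall i, `[-1, 1]%classic (v ord0 i)].
  by apply: (@rV_compact R m (fun=> `[-1, 1]%classic)) => i; exact: segment_compact.
have := compact_setX (compact_setX c01 c11) (@segment_compact R 0 S).
congr compact; apply/seteqP; split=> -[[a t] s].
  move=> [[/= ha ht] hs]; split=> [j|j|].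
  - by have := ha j; rewrite /= in_itv.
  - by have := ht j; rewrite /= in_itv/= -ler_norml.
  - by move: hs; rewrite in_itv.
move=> [ha ht hs]; split; [split|] => /=.
- by move=> j; rewrite in_itv; exact: ha.
- by move=> j; rewrite in_itv/= -ler_norml; exact: ht.
- by rewrite in_itv.
Qed.

Lemma valid_mix_le1 (R : realType) (m : nat) (a p : 'I_m -> R) j :
  valid_mix a p -> 0 <= a j <= 1.
Proof.
move=> [a0 a1]; rewrite a0/= -a1 (bigD1 j)//= lerDl.
by apply: sumr_ge0.
Qed.

(** The compact box does not impose total weight 1; this open condition disposes of its points off
    the simplex. *)
Lemma near_sum_weight_neq1 (R : realType) (m : nat) (th : @param R m) :
  \sum_j weight th j != 1 -> \forall u \near th, \sum_j weight u j != 1.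
Proof.
move=> h.
have cw : \sum_j weight u j @[u --> th] --> \sum_j weight th j.
  apply: cvg_big => [|j _]; first exact: add_continuous.
  by move=> A hA; exact: near_weight hA.
have h0 : 0 < `|\sum_j weight th j - 1| by rewrite normr_gt0 subr_eq0.
move/cvgrPdist_lt : cw => /(_ _ h0); apply: filterS => u; apply: contraTneq => ->.
by rewrite ltxx.
Qed.

Theorem theorem1 (R : realType) (m : nat) (f : R -> R)
  (d : measure_display) (T : measurableType d) (P : probability T R)
  (X : nat -> T -> R)
  (alpha0 mu0 : 'I_m -> R) (sigma0 : R)
  (ealpha emu : nat -> T -> 'I_m -> R) (esigma : nat -> T -> R) (c : R) :
  (0 < m)%N ->
  (* f(.;0,1) is a probability density *)
  (forall x, 0 <= f x) ->
  measurable_fun [set: R] f ->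
  (\int[@lebesgue_measure R]_(x in [set: R]) (f x)%:E = 1)%E ->
  (* (C1) identifiability *)
  (forall (a1 m1 a2 m2 : 'I_m -> R) (s1 s2 : R),
     valid_mix a1 m1 -> valid_mix a2 m2 -> 0 < s1 -> 0 < s2 ->
     (forall x, mixdens f a1 m1 s1 x = mixdens f a2 m2 s2 x) ->
     (forall t, mixCDF a1 m1 t = mixCDF a2 m2 t) /\ s1 = s2) ->
  (* true parameter *)
  valid_mix alpha0 mu0 -> 0 < sigma0 ->
  (* (C2) *)
  (\int[@lebesgue_measure R]_(x in [set: R])
     (`|ln (mixdens f alpha0 mu0 sigma0 x)| * mixdens f alpha0 mu0 sigma0 x)%:E
     < +oo)%E ->
  (* (C3) *)
  (exists v0 v1 beta : R, [/\ 0 < v0, 0 < v1, 1 < beta &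
     forall x, f x <= v0 /\ (x != 0 -> f x <= v1 * `|x| `^ (- beta))]) ->
  (* (C4) *)
  continuous f ->
  (* X_1, X_2, ... i.i.d. with density g(.; Psi0, sigma0) *)
  (forall i, measurable_fun [set: T] (X i)) ->
  (forall i (A : set R), measurable A ->
     P (X i @^-1` A) =
     (\int[@lebesgue_measure R]_(x in A) (mixdens f alpha0 mu0 sigma0 x)%:E)%E) ->
  mutually_independent P X ->
  (* estimator with values in Psi_m x (0, oo), a function of X_1..X_n *)
  (forall n w, valid_mix (ealpha n w) (emu n w) /\ 0 < esigma n w) ->
  (forall n w w', (forall i, (i < n)%N -> X i w = X i w') ->
     [/\ ealpha n w = ealpha n w', emu n w = emu n w' & esigma n w = esigma n w']) ->
  (* likelihood condition: l_n(bar) - l_n(0) >= c for all n *)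
  (forall n w, (0 < n)%N ->
     (loglik f alpha0 mu0 sigma0 n (fun i => X i w) + c%:E <=
      loglik f (ealpha n w) (emu n w) (esigma n w) n (fun i => X i w))%E) ->
  {ae P, forall w,
     (Dist (ealpha n w) (emu n w) alpha0 mu0 @[n --> \oo] --> 0%E) /\
     (esigma n w @[n --> \oo] --> sigma0)}.
Proof.
move=> _ f0 _ f1 ident valid0 sigma0_gt0 _ [v0 [v1 [beta [v0_gt0 v1_gt0 beta_gt1 fle]]]].
move=> cf mX lawX indX est _ lik.
have fv0 x : f x <= v0 by case: (fle x).
have fv1 x : x != 0 -> f x <= v1 * `|x| `^ (- beta) by case: (fle x).
(* With this choice [beta * (1 - s)] is [(beta + 1) / 2], which exceeds 1. *)
pose s := (1 - beta^-1) / 2.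
have beta_gt0 : 0 < beta by exact: lt_trans beta_gt1.
have binv : 0 < beta^-1 < 1 by rewrite invr_gt0 beta_gt0/= invf_lt1.
have s01 : 0 < s < 1 by apply/andP; split; rewrite /s; lra.
have sbeta : 1 < beta * (1 - s).
  have -> : beta * (1 - s) = (beta + 1) / 2 by rewrite /s; field; rewrite gt_eqF.
  by lra.
pose g0 := mixdens f alpha0 mu0 sigma0.
have g0_ge0 x : 0 <= g0 x by apply: mixdens_ge0 => //; case: valid0.
have g0_int1 : (\int[@lebesgue_measure R]_x (g0 x)%:E = 1)%E.
  exact: (integral_density1 lawX).
pose lmix q := \prod_(i < q.2) mixdens f (ealpha q.2 q.1) (emu q.2 q.1)
  (esigma q.2 q.1) (X i q.1).
have likP : ae_eventually P [set q |
    expR c * \prod_(i < q.2) g0 (X i q.1) <= lmix q].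
  apply: filterS (ae_density_gt0 f0 cf valid0 sigma0_gt0 mX lawX) => w gpos.
  near=> n; apply: sum_elog_le_prod => [i|]; first exact: gpos.
  by apply: lik; near: n; exact: nbhs_infty_gt.
have [D D0 evD] := likelihood_lower_bound f0 cf v0_gt0 v1_gt0 beta_gt1 fv0 fv1
  valid0 sigma0_gt0 mX lawX indX s01 sbeta c.
(* A mixture density is at most [v0] over its scale, so a likelihood above [D ^+ n] bounds the
   scale. This closes the compact box from above. *)
have evS : ae_eventually P [set q | esigma q.2 q.1 <= v0 / D].
  apply: filterS2 likP evD => -[w n] /= h1 h2.
  have [va sg0] := est n w.
  have : D ^+ n < (v0 / esigma n w) ^+ n.
    apply: (lt_le_trans (lt_le_trans h2 h1)); rewrite /lmix /=.
    rewrite (_ : (v0 / _) ^+ n = \prod_(i < n) (v0 / esigma n w)); last first.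
      by rewrite prodr_const card_ord.
    apply: ler_prod => i _.
    rewrite mixdens_ge0//=; last by case: va.
    by apply: mixdens_le => // j; exact: locscale_le.
  move=> h; have : D <= v0 / esigma n w.
    rewrite leNgt; apply/negP => hlt; move: h; apply/negP; rewrite -leNgt.
    by rewrite lerXn2r ?nnegrE ?(ltW D0)// ?divr_ge0 ?ltW.
  by rewrite ler_pdivlMr// ler_pdivlMr// mulrC.
have evL : ae_eventually P [set q | D ^+ q.2 < lmix q].
  by apply: filterS2 evD likP => q; exact: lt_le_trans.
have key e : 0 < e -> ae_eventually P [set q |
    (Dist (ealpha q.2 q.1) (emu q.2 q.1) alpha0 mu0 < e%:E)%E /\
    `|esigma q.2 q.1 - sigma0| < e].
  move=> e0.
  (* Compactness turns the local statement [loc], valid near each [th] and almost surely eventually,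
     into one valid on the whole box at once; it is then read at the encoded estimate. *)
  have /compact_near_coveringP := @compact_param_box R m (v0 / D).
  move=> /(_ (T * nat)%type (ae_eventually P) (fun q th =>
    th = encode (ealpha q.2 q.1) (emu q.2 q.1) (esigma q.2 q.1) ->
    (Dist (ealpha q.2 q.1) (emu q.2 q.1) alpha0 mu0 < e%:E)%E /\
    `|esigma q.2 q.1 - sigma0| < e) _).
  have loc th : [/\ forall j, 0 <= weight th j <= 1,
      forall j, `|location th j| <= 1 & 0 <= th.2 <= v0 / D] ->
    \forall u \near th & q \near ae_eventually P,
      u = encode (ealpha q.2 q.1) (emu q.2 q.1) (esigma q.2 q.1) ->
      (Dist (ealpha q.2 q.1) (emu q.2 q.1) alpha0 mu0 < e%:E)%E /\
      `|esigma q.2 q.1 - sigma0| < e.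
    move=> [a01 t1 /andP[]]; rewrite le0r => /predU1P[th0 _|th0 _].
      (* At zero scale the likelihood is at most [D ^+ n], against [evL]. *)
      have h := small_scale f0 cf v0_gt0 v1_gt0 beta_gt1 fv0 fv1
        valid0 sigma0_gt0 mX lawX indX D0 t1 th0.
      apply: filterS2 h (@near_prod_snd _ _ (nbhs th) (ae_eventually P) _ _ evL).
      move=> [u [w n]] /= h1 h2 uE; exfalso; have [va sg0] := est n w.
      by move: h2; apply/negP; rewrite -leNgt; exact: h1 uE.
    have a0 j : 0 <= weight th j by case/andP: (a01 j).
    have [a1|/near_sum_weight_neq1 h] := eqVneq (\sum_j weight th j) 1; last first.
      apply: filterS (@near_prod_fst _ _ (nbhs th) (ae_eventually P) _ _ h).
      move=> [u [w n]] /= h1 uE; exfalso; have [[_ va] _] := est n w.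
      move: h1; apply/negP; rewrite negbK uE -[X in _ == X]va; apply/eqP.
      by apply: eq_bigr => j _; rewrite /weight mxE.
    have [eqg|neqg] := pselect (forall x, mixlim f th x = g0 x).
      have h := near_identified f0 cf f1 valid0 sigma0_gt0 ident g0_int1
        a0 a1 t1 th0 eqg e0.
      apply: filterS (@near_prod_fst _ _ (nbhs th) (ae_eventually P) _ _ h).
      by move=> [u [w n]] /= h1 uE; exact: h1 uE.
    (* Only finite locations contribute, so the mass is a partial sum of the weights. *)
    have ml1 : (\int[@lebesgue_measure R]_x (mixlim f th x)%:E <= 1)%E.
      rewrite integral_mixlim// lee_fin -[leRHS]a1.
      by rewrite [leRHS](bigID (fun j => `|location th j| < 1))/= lerDl sumr_ge0.
    have hlt1 : (\int[@lebesgue_measure R]_x (mixlim f th x `^ s * g0 x `^ (1 - s))%:E < 1)%E.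
      apply: hellinger_lt1 => //.
      - by move=> x; exact: mixlim_ge0.
      - exact: continuous_mixlim.
      - exact: continuous_mixdens.
      - by rewrite g0_int1.
    have [G [G0 mG G1 nearG]] := exists_envelope f0 cf v0_gt0 v1_gt0 beta_gt1 fv0 fv1
      valid0 sigma0_gt0 s01 sbeta a0 t1 th0 hlt1.
    have evG := prod_envelope_lt f0 cf valid0 sigma0_gt0 mX lawX indX s01 c G0 mG G1.
    (* The likelihood of the estimate exceeds the product of [G], so its density cannot lie below
       [G] everywhere. *)
    have evG' : ae_eventually P [set q | \prod_(i < q.2) G (X i q.1) < lmix q].
      by apply: filterS2 evG likP => q; exact: lt_le_trans.
    apply: filterS2 (@near_prod_fst _ _ (nbhs th) (ae_eventually P) _ _ nearG)
      (@near_prod_snd _ _ (nbhs th) (ae_eventually P) _ _ evG').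
    move=> [u [w n]] /= h1 h2 uE; exfalso; have [va sg0] := est n w.
    move: h2; apply/negP; rewrite -leNgt; apply: ler_prod => i _.
    by rewrite mixdens_ge0//=; [exact: h1 uE _|case: va].
  move=> /(_ loc) cover.
  apply: filterS2 cover evS => -[w n] /= cov sgS.
  have [va sg0] := est n w.
  apply: (cov (encode (ealpha n w) (emu n w) (esigma n w))) => //; split.
  - by move=> j; rewrite /weight mxE; exact: valid_mix_le1 va.
  - by move=> j; rewrite /location mxE; exact/ltW/contractR_norm_lt1.
  - by rewrite /= ltW.
(* Restricting the tolerance to the values [1 / (k + 1)] leaves countably many null sets, so one
   null set serves all tolerances. *)
have : {ae P, forall w, forall k, \forall n \near \oo,
    (Dist (ealpha n w) (emu n w) alpha0 mu0 < (k.+1%:R^-1)%:E)%E /\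
    `|esigma n w - sigma0| < k.+1%:R^-1}.
  by apply: ae_foralln => k; apply: (key k.+1%:R^-1); rewrite invr_gt0.
apply: filterS => w hw; split.
  apply/fine_cvgP; split.
    apply: filterS (hw 0) => n [h _]; rewrite ge0_fin_numE; first exact: lt_trans h (ltry _).
    by apply: integral_ge0 => t _; rewrite lee_fin mulr_ge0 ?expR_ge0.
  apply/cvgrPdist_lt => e e0; near \oo => k.
  have ke : k.+1%:R^-1 < e by near: k; exact: (near_infty_natSinv_lt (PosNum e0)).
  apply: filterS (hw k) => n [h _].
  have h0 : (0 <= Dist (ealpha n w) (emu n w) alpha0 mu0)%E.
    by apply: integral_ge0 => t _; rewrite lee_fin mulr_ge0 ?expR_ge0.
  rewrite sub0r normrN ger0_norm ?fine_ge0//; apply: lt_trans ke.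
  by rewrite -lte_fin fineK// ge0_fin_numE//; exact: lt_trans h (ltry _).
apply/cvgrPdist_lt => e e0; near \oo => k.
have ke : k.+1%:R^-1 < e by near: k; exact: (near_infty_natSinv_lt (PosNum e0)).
by apply: filterS (hw k) => n [_ h]; rewrite distrC; exact: lt_trans h ke.
Unshelve. all: by end_near. Qed.
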